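(* Let $\nu$ be a partition of type 1 such that $(\nu_1^{\nu_1-1})\subseteq\nu$. Then $\nu$ is not covered by any partition $\mu$ with $\nu\subseteq\mu$, $|\mu|=|\nu|+1$ and $\mu\neq\nu+(1)$, where $\nu+(1)$ is obtained from $\nu$ by adding one box at the end of its first row.
   Context: Partitions are identified with their Young diagrams (English convention); $\lambda'$ is the conjugate of $\lambda$, $|\lambda|$ its size, $\ell(\lambda)$ its number of nonzero parts, and $\mu\subseteq\lambda$ means $\mu_i\le\lambda_i$ for all $i$. $(a^b)$ denotes the partition with $b$ parts equal to $a$. For a partition $\mu\subseteq(m^m)$, its complement $\mu^c$ is the partition $(m-\mu_m,\dots,m-\mu_1)$ (the skew shape $(m^m)/\mu$ rotated by $180^\circ$). A symmetric function is Schur-positive if all coefficients of its Schur expansion are nonnegative. For partitions $\nu\subseteq\mu$ with $|\mu|=|\nu|+1$, $\mu$ covers $\nu$ if $s_{\mu'}s_{\mu^c}-s_{\nu'}s_{\nu^c}$ is Schur-positive, with both complements taken in the same square $(m^m)$, $m\ge\mu_1+\ell(\mu)$. A partition $\nu$ is of type 1 if, with $i=\nu_1$, $\nu$ contains $(i,i,i-1,\dots,2,1)$. *)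

(* Defs.v *)
From mathcomp Require Import all_boot all_order all_algebra.
From mathcomp Require Import mpoly.

Set Implicit Arguments.
Unset Strict Implicit.
Unset Printing Implicit Defensive.

Import GRing.Theory Num.Theory.

(* A partition is the weakly decreasing sequence of its nonzero parts, so that
   [size la] is its length, [sumn la] its size and [head 0 la] its first part.
   Rows, columns and parts are numbered from 0. *)
Definition is_part (la : seq nat) : bool := sorted geq la && (0 \notin la).

Definition part_incl (nu mu : seq nat) : Prop :=
  forall i, nth 0 nu i <= nth 0 mu i.

Definition conj_part (la : seq nat) : seq nat :=
  mkseq (fun j => count (fun a => j < a) la) (head 0 la).

(* Meaningful when [mu] is contained in the m x m square. *)
Definition compl_part (m : nat) (mu : seq nat) : seq nat :=
  [seq a <- rev (mkseq (fun i => m - nth 0 mu i) m) | 0 < a].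

Definition box (la : seq nat) := {i : 'I_(size la) & 'I_(nth 0 la i)}.

Definition brow la (b : box la) : nat := tag b.
Definition bcol la (b : box la) : nat := tagged b.

Definition semistandard la N (T : {ffun box la -> 'I_N}) : bool :=
  [forall b : box la, forall b' : box la,
     ((brow b == brow b') && (bcol b < bcol b') ==> (T b <= T b'))
  && ((bcol b == bcol b') && (brow b < brow b') ==> (T b < T b'))].

Local Open Scope ring_scope.

Definition schur (la : seq nat) (N : nat) : {mpoly int[N]} :=
  \sum_(T : {ffun box la -> 'I_N} | semistandard T) \prod_b 'X_(T b).

(* A symmetric function is given by the family of its specializations to
   finitely many variables x_1, ..., x_N, for all N.  As the Schur functions
   form a basis, the expansion below (a finite linear combination, independent
   of N) is unique. *)
Definition schur_expansion (f : forall N, {mpoly int[N]})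
    (r : seq (seq nat)) (c : seq nat -> int) : Prop :=
  [/\ uniq r, all is_part r
    & forall N, f N = \sum_(la <- r) c la *: schur la N].

Definition schur_positive (f : forall N, {mpoly int[N]}) : Prop :=
  exists r c, schur_expansion f r c /\ (forall la, la \in r -> 0 <= c la).

Local Close Scope ring_scope.

(* The complements are both taken in the m x m square, for a side
   m >= head 0 mu + size mu. *)
Definition covers (m : nat) (mu nu : seq nat) : Prop :=
  [/\ part_incl nu mu, sumn mu = (sumn nu).+1
    & schur_positive (fun N =>
        schur (conj_part mu) N * schur (compl_part m mu) N
        - schur (conj_part nu) N * schur (compl_part m nu) N)%R].

Definition type1 (nu : seq nat) : Prop :=
  part_incl (head 0 nu :: rev (iota 1 (head 0 nu))) nu.

(* Main.v *)
Require Import Defs.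
From mathcomp Require Import all_boot all_order all_fingroup all_algebra.
From mathcomp Require Import mpoly zify ring.

(** Fix [m] variables, write [V] for the Vandermonde determinant and [alt l] for
    the determinant of the [x_i ^ l_j].  For symmetric polynomials [G1] and [G2],
    the coefficient of a suitable power of [x_1 ... x_m] in [V * V * f * G1 * G2]
    is a linear function of [f].  Take [G1 = e_q * e_1 ^ k] and let [G2] be
    [h_q * e_1 ^ k] in the inverse variables, up to a power of [x_1 ... x_m].
    By the Pieri rules the function is then, up to a sign, nonnegative on Schur
    polynomials.  As [s_(nu^c)] is [s_nu] in the inverse variables, its value at
    [s_(nu') * s_(nu^c)] is [m!] times the number of ways to reach a common
    partition [kappa] from [nu'] by a vertical strip of size [q] and [k] boxes, and
    from [nu] by a horizontal strip of size [q] and [k] boxes.  So it suffices to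
    find [q] and [k] for which such a [kappa] exists for [nu] and not for [mu].

    If the box of [mu / nu] is in row [nu_1] (counted from 0) or lower, adding it
    adds two boxes to the union of [nu] and [nu'], and [q = 0] with
    [kappa] the union of [nu] and [nu'] does.  Otherwise that box lies in row
    [nu_1 - 1], and [kappa] is the union with three more corners, [q] being
    the number of rows of [kappa / nu']; for [mu] the row count forces the
    boxes outside the union into distinct new rows, and then fewer than [q]
    columns of [kappa / mu] are nonempty. *)

Set Implicit Arguments.
Unset Strict Implicit.
Unset Printing Implicit Defensive.

Import GRing.Theory Num.Theory.

Local Open Scope ring_scope.

(** * Alternants and Pieri rules *)

(** [P] is left abstract because the same rules serve the powers [x_i ^ a] and the reflected powers
    [x_i ^ (K - a)], which replace inverse variables. *)
Definition alt (R : comNzRingType) m (P : 'I_m -> nat -> R) (l : 'I_m -> nat) : R :=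
  \det (\matrix_(i, j) P i (l j)).

Lemma eq_alt (R : comNzRingType) m (P : 'I_m -> nat -> R) l l' :
  l =1 l' -> alt P l = alt P l'.
Proof. by move=> e; congr (\det _); apply/matrixP=> i j; rewrite !mxE e. Qed.

Lemma alt_leibniz (R : comNzRingType) m (P : 'I_m -> nat -> R) l :
  alt P l = \sum_(s : 'S_m) (-1) ^+ s * \prod_i P i (l (s i)).
Proof.
by apply: eq_bigr => s _; congr (_ * _); apply: eq_bigr => i _; rewrite mxE.
Qed.

Lemma alt_eq0 (R : comNzRingType) m (P : 'I_m -> nat -> R) l i j :
  i != j -> l i = l j -> alt P l = 0.
Proof.
move=> nij e; rewrite /alt -det_tr.
by apply: (determinant_alternate nij) => x; rewrite !mxE e.
Qed.

Lemma alt_tperm (R : comNzRingType) m (P : 'I_m -> nat -> R) l i j :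
  i != j -> alt P (fun k => l (tperm i j k)) = - alt P l.
Proof.
move=> nij.
have -> : alt P (fun k => l (tperm i j k)) =
  \det (col_perm (tperm i j) (\matrix_(i, j) P i (l j))).
  by congr (\det _); apply/matrixP=> x y; rewrite !mxE.
rewrite col_permE det_mulmx tpermV det_perm odd_tperm nij /= expr1 mulrN mulr1.
by [].
Qed.

(** With [u i g = x_i ^ g] this is the elementary symmetric polynomial [e_q] for [c = 2] and the
    complete one [h_q] for [c = q.+1]. *)
Definition symsum (R : comNzRingType) m c q (u : 'I_m -> nat -> R) : R :=
  \sum_(g : {ffun 'I_m -> 'I_c} | (\sum_i g i == q)%N) \prod_i u i (g i).

(** The set of increments [g] is stable under permutation, so in the Leibniz term of [s] they are
    reindexed along [s], and [g j] then belongs to column [j]. [P'] may differ from [P] because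
    reflected powers change their [K]. *)
Lemma alt_symsum (R : comNzRingType) m c q (P P' u : 'I_m -> nat -> R) l :
  (forall i j (g : 'I_c), P i (l j) * u i g = P' i (l j + g)%N) ->
  alt P l * symsum c q u =
  \sum_(g : {ffun 'I_m -> 'I_c} | (\sum_i g i == q)%N) alt P' (fun j => l j + g j)%N.
Proof.
move=> h; rewrite alt_leibniz mulr_suml.
under [RHS]eq_bigr do rewrite alt_leibniz.
rewrite [RHS]exchange_big; apply: eq_bigr => s _.
pose f (g : {ffun 'I_m -> 'I_c}) := [ffun j => g (s j)].
pose f' (g : {ffun 'I_m -> 'I_c}) := [ffun j => g (s^-1%g j)].
rewrite /symsum (reindex_onto f f') /=; last first.
  by move=> g _; apply/ffunP=> j; rewrite !ffunE permK.
rewrite mulr_sumr; apply: eq_big => [g|g _].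
  have -> : f' (f g) == g by apply/eqP/ffunP=> j; rewrite !ffunE permKV.
  rewrite andbT (reindex_inj (@perm_inj _ s^-1%g)) /=.
  by under eq_bigr do rewrite ffunE permKV.
rewrite -mulrA -big_split /=; congr (_ * _).
by apply: eq_bigr => i _; rewrite ffunE h.
Qed.

Definition strict m (l : 'I_m -> nat) :=
  [forall i : 'I_m, forall j : 'I_m, (i < j)%N ==> (l j < l i)%N].

Lemma strictP m (l : 'I_m -> nat) :
  reflect (forall i j : 'I_m, (i < j)%N -> (l j < l i)%N) (strict l).
Proof.
apply: (iffP 'forall_forallP) => h i j; first by move/implyP: (h i j).
exact/implyP/h.
Qed.

(** Increments 0 or 1 keep a strictly decreasing vector weakly decreasing, so a result that is not
    strict has two equal exponents and a vanishing alternant. *)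
Lemma alt_vpieri (R : comNzRingType) m q (P P' u : 'I_m -> nat -> R) l :
  (forall i j (g : 'I_2), P i (l j) * u i g = P' i (l j + g)%N) -> strict l ->
  alt P l * symsum 2 q u =
  \sum_(g : {ffun 'I_m -> 'I_2} | (\sum_i g i == q)%N && strict (fun j => l j + g j)%N)
    alt P' (fun j => l j + g j)%N.
Proof.
move=> h /strictP sl; rewrite (alt_symsum q h) big_mkcondr /=.
apply: eq_bigr => g _; case: ifPn => // /forallPn[i /forallPn[j]].
rewrite negb_imply -leqNgt => /andP[lij].
have := sl _ _ lij; have := ltn_ord (g i); have := ltn_ord (g j).
move=> g1 g2 lt le; apply: (@alt_eq0 _ _ _ _ i j); last by lia.
by apply/eqP=> e; rewrite e ltnn in lij.
Qed.

(** For exponents of the form [la_j + n - j] this is the horizontal strip condition between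
    consecutive rows, imposed only on rows from [J] on: it is vacuous at [J = m] and complete at
    [J = 0]. *)
Definition interl m (l l' : 'I_m -> nat) J :=
  [forall i : 'I_m, forall j : 'I_m, (i.+1 == j :> nat) && (J <= j)%N ==> (l' j < l i)%N].

Lemma interlP m (l l' : 'I_m -> nat) J :
  reflect (forall i j : 'I_m, i.+1 = j :> nat -> (J <= j)%N -> (l' j < l i)%N) (interl l l' J).
Proof.
apply: (iffP 'forall_forallP) => h i j.
  by move=> e le; apply: (implyP (h i j)); rewrite e eqxx.
by apply/implyP => /andP[/eqP e le]; exact: h.
Qed.

(* Row by row: the terms violating the interlacing condition at row [J] cancel
   in pairs, by exchanging the exponents of rows [J - 1] and [J]. *)
Lemma alt_interl_step (R : comNzRingType) m q (P : 'I_m -> nat -> R) l J :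
  (forall x : R, x = - x -> x = 0) -> strict l ->
  \sum_(g : {ffun 'I_m -> 'I_q.+1} | (\sum_i g i == q)%N &&
      interl l (fun j => l j + g j)%N J.+1)
    alt P (fun j => l j + g j)%N =
  \sum_(g : {ffun 'I_m -> 'I_q.+1} | (\sum_i g i == q)%N &&
      interl l (fun j => l j + g j)%N J)
    alt P (fun j => l j + g j)%N.
Proof.
move=> H2 /strictP sl.
have [/andP[J0 Jm]|nJ] := boolP (0 < J < m)%N; last first.
  apply: eq_bigl => g; congr (_ && _); apply/interlP/interlP => h i j e le.
    apply: h => //; have := ltn_ord j; move: nJ; rewrite negb_and; lia.
  by apply: h => //; lia.
have J1m : (J.-1 < m)%N by lia.
pose j0 := Ordinal Jm; pose i0 := Ordinal J1m.
have nij : i0 != j0 by apply/eqP => /(congr1 val) /=; lia.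
have lij : (l j0 < l i0)%N by apply: sl; rewrite /=; lia.
pose good J (g : {ffun 'I_m -> 'I_q.+1}) :=
  (\sum_i g i == q)%N &&
      interl l (fun j => l j + g j)%N J.
pose bad (g : {ffun 'I_m -> 'I_q.+1}) := good J.+1 g && (l i0 <= l j0 + g j0)%N.
rewrite (bigID (fun g : {ffun 'I_m -> 'I_q.+1} => l i0 <= l j0 + g j0)%N) /=.
rewrite -/(good J.+1) [X in X + _](_ : _ = 0) ?add0r; last first.
  apply: H2.
  (* [f] exchanges the resulting exponents, not the increments. The two new increments are
     nonnegative because [g] violates the condition, and they have the same sum as the old ones, so
     they stay at most [q]. *)
  pose f (g : {ffun 'I_m -> 'I_q.+1}) : {ffun 'I_m -> 'I_q.+1} :=
    [ffun j => inord (l (tperm i0 j0 j) + g (tperm i0 j0 j) - l j)].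
  have fE g : bad g -> forall j, (l j + f g j = l (tperm i0 j0 j) + g (tperm i0 j0 j))%N.
    case/andP => /andP[/eqP sq _] hb j.
    have H : (g i0 + g j0 <= q)%N.
      apply: leq_trans (eq_leq sq).
      by rewrite (bigD1 i0) //= (bigD1 j0) 1?eq_sym //= addnA leq_addr.
    rewrite ffunE inordK; last first.
      case: tpermP => [->|->|_ _]; last by have := ltn_ord (g j); lia.
        by lia.
      by lia.
    by case: tpermP => [->|->|_ _]; lia.
  have fbad g : bad g -> bad (f g).
    move=> bg; have E := fE _ bg; case/andP: (bg) => /andP[/eqP sq /interlP hi] hb.
    apply/andP; split; last by rewrite E tpermR leq_addr.
    apply/andP; split.
      have : (\sum_i (l i + f g i) = \sum_i (l i + g i))%N.
        under eq_bigr do rewrite E.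
        by rewrite [RHS](reindex_inj (@perm_inj _ (tperm i0 j0))).
      by rewrite !big_split /= sq => /addnI ->.
    apply/interlP => i j e le; rewrite E tpermD; first exact: hi.
      by apply/eqP => /(congr1 val) /=; lia.
    by apply/eqP => /(congr1 val) /=; lia.
  have ff g : bad g -> f (f g) = g.
    move=> bg; apply/ffunP => j; apply/val_inj/(@addnI (l j)).
    by rewrite (fE _ (fbad _ bg)) (fE _ bg) tpermK.
  rewrite {1}(reindex_onto f f) /=; last by move=> g; apply: ff.
  rewrite -sumrN; apply: eq_big => [g|g].
    apply/andP/idP => [[bf /eqP e]|bg].
      by rewrite -e; exact: fbad.
    by split; [exact: fbad|rewrite ff].
  move=> /andP[bf /eqP e]; have bg : bad g by rewrite -e; exact: fbad.
  rewrite -(alt_tperm P (fun j => (l j + g j)%N) nij).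
  by apply: eq_alt => j; rewrite fE.
apply: eq_bigl => g; rewrite /good -andbA; congr (_ && _).
apply/andP/interlP => [[/interlP h1 h2] i j e|h].
  rewrite leq_eqVlt => /orP[/eqP ej|]; last exact: h1.
  have -> : j = j0 by apply: val_inj.
  have -> : i = i0 by apply: val_inj => /=; lia.
  by rewrite ltnNge.
split; first by apply/interlP => i j e le; apply: h => //; exact: ltnW.
by rewrite -ltnNge; apply: h => //=; lia.
Qed.

(** Lowering [J] from [m] to 0 turns the unrestricted sum of [alt_symsum] into the sum over
    horizontal strips. *)
Lemma alt_hpieri (R : comNzRingType) m q (P P' u : 'I_m -> nat -> R) l :
  (forall x : R, x = - x -> x = 0) ->
  (forall i j (g : 'I_q.+1), P i (l j) * u i g = P' i (l j + g)%N) -> strict l ->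
  alt P l * symsum q.+1 q u =
  \sum_(g : {ffun 'I_m -> 'I_q.+1} | (\sum_i g i == q)%N && interl l (fun j => l j + g j)%N 0)
    alt P' (fun j => l j + g j)%N.
Proof.
move=> H2 h sl; rewrite (alt_symsum q h).
have E J : \sum_(g : {ffun 'I_m -> 'I_q.+1} |
      (\sum_i g i == q)%N &&
      interl l (fun j => l j + g j)%N J)
    alt P' (fun j => l j + g j)%N =
  \sum_(g : {ffun 'I_m -> 'I_q.+1} |
      (\sum_i g i == q)%N && interl l (fun j => l j + g j)%N 0)
    alt P' (fun j => l j + g j)%N.
  by elim: J => // J IH; rewrite alt_interl_step // IH.
rewrite -(E m); apply: eq_bigl => g; case: eqP => //= _.
by symmetry; apply/interlP => i j _; rewrite leqNgt ltn_ord.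
Qed.

Lemma strict_adj m (l : 'I_m -> nat) :
  (forall i j : 'I_m, i.+1 = j -> (l j < l i)%N) -> strict l.
Proof.
move=> h; apply/strictP => i [j lj] /=; elim: j lj => // j IH lj.
have lj' : (j < m)%N by exact: ltnW.
have lt : (l (Ordinal lj) < l (Ordinal lj'))%N by exact: h.
rewrite ltnS leq_eqVlt => /orP[/eqP e|/IH]; last by move/(_ lj'); exact: ltn_trans.
by have -> : i = Ordinal lj' by exact: val_inj.
Qed.

(** * Strips and single boxes as lists of exponent vectors *)

Definition vadd m q (l : {ffun 'I_m -> nat}) : seq {ffun 'I_m -> nat} :=
  [seq [ffun j => (l j + g j)%N] | g : {ffun 'I_m -> 'I_2} in
     [pred g : {ffun 'I_m -> 'I_2} |
     (\sum_i g i == q)%N && strict (fun j => l j + g j)%N]].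

Definition hadd m q (l : {ffun 'I_m -> nat}) : seq {ffun 'I_m -> nat} :=
  [seq [ffun j => (l j + g j)%N] | g : {ffun 'I_m -> 'I_q.+1} in
     [pred g : {ffun 'I_m -> 'I_q.+1} |
     (\sum_i g i == q)%N && interl l (fun j => l j + g j)%N 0]].

Lemma eq_strict m (l l' : 'I_m -> nat) : l =1 l' -> strict l = strict l'.
Proof. by move=> e; apply/strictP/strictP => h i j; move/h; rewrite !e. Qed.

Lemma vaddP m q (l l' : {ffun 'I_m -> nat}) :
  reflect [/\ strict l', forall j, (l j <= l' j <= (l j).+1)%N
             & (\sum_j l' j = \sum_j l j + q)%N]
          (l' \in vadd q l).
Proof.
apply: (iffP imageP) => [[g /andP[/eqP sq st] ->]|[st h sq]].
  split=> [|j|]; first by rewrite -(eq_strict (l := fun j => (l j + g j)%N)) // => j;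
    rewrite ffunE.
    rewrite ffunE leq_addr -[(l j).+1]addn1 leq_add2l; exact: (ltn_ord (g j)).
  by under eq_bigr do rewrite ffunE; rewrite big_split /= sq.
have E j : (l j + (inord (l' j - l j)%N : 'I_2) = l' j)%N.
  by rewrite inordK; have := h j; lia.
exists [ffun j => inord (l' j - l j)]; last first.
  by apply/ffunP => j; rewrite !ffunE E.
apply/andP; split.
  rewrite -(eqn_add2l (\sum_j l j)%N) -big_split /= -sq.
  by apply/eqP/eq_bigr => j _; rewrite ffunE E.
by rewrite (eq_strict (l' := l')) // => j; rewrite ffunE E.
Qed.

Lemma haddP m q (l l' : {ffun 'I_m -> nat}) :
  reflect [/\ forall j, (l j <= l' j)%N,
              forall i j : 'I_m, i.+1 = j -> (l' j < l i)%N
             & (\sum_j l' j = \sum_j l j + q)%N]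
          (l' \in hadd q l).
Proof.
apply: (iffP imageP) => [[g /andP[/eqP sq /interlP st] ->]|[h st sq]].
  split=> [j|i j e|]; first by rewrite ffunE leq_addr.
    by rewrite ffunE; apply: st.
  by under eq_bigr do rewrite ffunE; rewrite big_split /= sq.
have sq' : (\sum_j (l' j - l j) = q)%N.
  by rewrite sumnB // sq addKn.
have E j : (l j + (inord (l' j - l j)%N : 'I_q.+1) = l' j)%N.
  rewrite inordK; first by have := h j; lia.
  by rewrite ltnS -sq' (bigD1 j) //= leq_addr.
exists [ffun j => inord (l' j - l j)]; last first.
  by apply/ffunP => j; rewrite !ffunE E.
apply/andP; split.
  apply/eqP; rewrite -[RHS]sq'; apply: eq_bigr => j _; rewrite ffunE.
  by apply: (@addnI (l j)); rewrite E subnKC.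
by apply/interlP => i j e _; rewrite ffunE E; apply: st.
Qed.

Lemma hadd_strict m q (l l' : {ffun 'I_m -> nat}) : l' \in hadd q l -> strict l'.
Proof.
case/haddP => h1 h2 _; apply: strict_adj => i j e.
exact: leq_trans (h2 _ _ e) (h1 i).
Qed.

Definition sadd (T : Type) (st : T -> seq T) s := flatten [seq st l | l <- s].

Lemma sum_alt_sadd (R : comNzRingType) m (P P' : 'I_m -> nat -> R) U
    (s : seq {ffun 'I_m -> nat}) (st : {ffun 'I_m -> nat} -> seq {ffun 'I_m -> nat}) :
  (forall l, l \in s -> alt P l * U = \sum_(l' <- st l) alt P' l') ->
  (\sum_(l <- s) alt P l) * U = \sum_(l <- sadd st s) alt P' l.
Proof.
move=> h; rewrite big_flatten big_map mulr_suml big_seq [RHS]big_seq.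
exact: eq_bigr.
Qed.

Lemma sum_alt_vadd (R : comNzRingType) m q (P P' u : 'I_m -> nat -> R)
    (s : seq {ffun 'I_m -> nat}) :
  (forall l, l \in s -> strict l) ->
  (forall l, l \in s -> forall i j (g : 'I_2), P i (l j) * u i g = P' i (l j + g)%N) ->
  (\sum_(l <- s) alt P l) * symsum 2 q u = \sum_(l <- sadd (vadd q) s) alt P' l.
Proof.
move=> st h; apply: sum_alt_sadd => l ls.
rewrite (alt_vpieri q (h l ls) (st l ls)) big_image.
by apply: eq_bigr => g _; apply: eq_alt => j; rewrite ffunE.
Qed.

Lemma sum_alt_hadd (R : comNzRingType) m q (P P' u : 'I_m -> nat -> R)
    (s : seq {ffun 'I_m -> nat}) :
  (forall x : R, x = - x -> x = 0) ->
  (forall l, l \in s -> strict l) ->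
  (forall l, l \in s -> forall i j (g : 'I_q.+1), P i (l j) * u i g = P' i (l j + g)%N) ->
  (\sum_(l <- s) alt P l) * symsum q.+1 q u = \sum_(l <- sadd (hadd q) s) alt P' l.
Proof.
move=> H2 st h; apply: sum_alt_sadd => l ls.
rewrite (alt_hpieri H2 (h l ls) (st l ls)) big_image.
by apply: eq_bigr => g _; apply: eq_alt => j; rewrite ffunE.
Qed.

Lemma mem_sadd (T : eqType) (st : T -> seq T) s x :
  reflect (exists2 l, l \in s & x \in st l) (x \in sadd st s).
Proof. exact: flatten_mapP. Qed.

Definition boxes m k (s : seq {ffun 'I_m -> nat}) := iter k (sadd (vadd 1)) s.

Lemma boxes_sound m k (s : seq {ffun 'I_m -> nat}) l' :
  (forall l, l \in s -> strict l) -> l' \in boxes k s ->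
  strict l' /\ exists2 l, l \in s &
    (forall j, (l j <= l' j)%N) /\ (\sum_j l' j = \sum_j l j + k)%N.
Proof.
move=> st; elim: k l' => [|k IH] l' /=.
  by move=> ls; split; [exact: st|exists l'; rewrite // addn0].
case/mem_sadd => l1 /IH[st1 [l ls [h1 h2]]] /vaddP[st' h3 h4]; split=> //.
exists l => //; split=> [j|]; last by rewrite h4 h2 -addnA addn1.
by apply: leq_trans (h1 j) _; case/andP: (h3 j).
Qed.

(** Induction on [k], removing a box of [l'] from the last row where it exceeds [l]: the rows after
    it agree with [l], which is strict, so the smaller vector is still strict. *)
Lemma boxes_complete m k (s : seq {ffun 'I_m -> nat}) (l l' : {ffun 'I_m -> nat}) :
  l \in s -> strict l -> strict l' -> (forall j, (l j <= l' j)%N) ->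
  (\sum_j l' j = \sum_j l j + k)%N -> l' \in boxes k s.
Proof.
move=> ls /strictP st; elim: k l' => [|k IH] l' /strictP st' h sk /=.
  suff -> : l' = l by [].
  apply/ffunP => j; apply/eqP; move: sk; rewrite addn0 => /esym/eqP.
  have /leqif_sum : forall i, true -> (l i <= l' i ?= iff (l i == l' i))%N.
    by move=> i _; apply: leqif_eq.
  by move=> -> /forallP/(_ j); rewrite eq_sym.
have [i0 Hi0] : exists i, (l i < l' i)%N.
  apply/existsP; apply: contraT => /existsPn hn.
  have : (\sum_j l' j <= \sum_j l j)%N by apply: leq_sum => i _; rewrite leqNgt hn.
  by rewrite sk; lia.
have [i Hi imax] := @arg_maxnP _ i0 (fun i => l i < l' i)%N val Hi0.
pose l1 := [ffun j => (l' j - (j == i))%N].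
have E j : (l1 j + (j == i) = l' j)%N.
  by rewrite ffunE; case: eqP => [->|_] /=; lia.
have S1 : (\sum_j l' j = \sum_j l1 j + 1)%N.
  rewrite -(eq_bigr _ (fun j _ => E j)) big_split /=; congr (_ + _)%N.
  by rewrite (bigD1 i) //= eqxx big1 // => j /negbTE ->.
have st1 : strict l1.
  apply/strictP => x y xy; have := E x; have := E y; have := st' _ _ xy.
  case: (altP (y =P i)) => [->|ny]; case: (altP (x =P i)) => [ex|nx] /=; try lia.
  have le : (l' y <= l y)%N by rewrite leqNgt; apply/negP => /imax /=; rewrite -ex; lia.
  by have := st _ _ xy; rewrite ex in Hi *; lia.
apply/mem_sadd; exists l1.
  apply: IH => // [j|]; last first.
    by apply: (@addIn 1); rewrite -S1 sk -addnA addn1.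
  by have := E j; have := h j; case: eqP => [->|_] /=; lia.
apply/vaddP; split=> // [|j]; first exact/strictP.
by have := E j; case: eqP => /=; lia.
Qed.

Lemma sum_alt_boxes (R : comNzRingType) m k (P : nat -> 'I_m -> nat -> R)
    (u : 'I_m -> nat -> R)
    (s : seq {ffun 'I_m -> nat}) :
  (forall l, l \in s -> strict l) ->
  (forall k l, l \in boxes k s ->
     forall i j (g : 'I_2), P k i (l j) * u i g = P k.+1 i (l j + g)%N) ->
  (\sum_(l <- s) alt (P 0%N) l) * symsum 2 1 u ^+ k = \sum_(l <- boxes k s) alt (P k) l.
Proof.
move=> st h; elim: k => [|k IH]; first by rewrite expr0 mulr1.
rewrite exprSr mulrA IH; apply: sum_alt_vadd => l ls; last exact: h.
by case: (boxes_sound st ls).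
Qed.

(** * Coefficients of products of alternants *)

Definition xpow m (i : 'I_m) (a : nat) : {mpoly int[m]} := 'X_i ^+ a.

(** This is [x_i ^ K] times the [a]-th power of the inverse of [x_i], which keeps inverse variables
    within polynomials; the truncated subtraction is faithful when [a <= K]. *)
Definition xcpow m K (i : 'I_m) (a : nat) : {mpoly int[m]} := 'X_i ^+ (K - a).

(** Both vectors list the same set of values in decreasing order, hence agree; injectivity then
    identifies the permutations. *)
Lemma strict_perm_eq m (l l' : {ffun 'I_m -> nat}) (s t : 'S_m) :
  strict l -> strict l' -> (forall i, l (s i) = l' (t i)) -> l = l' /\ s = t.
Proof.
move=> st st' h.
have srt (f : {ffun 'I_m -> nat}) : strict f -> sorted gtn (codom f).
  move/strictP => sf; rewrite /codom /image_mem sorted_map.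
  have : sorted (relpre val ltn) (enum 'I_m).
    by rewrite -sorted_map val_enum_ord iota_ltn_sorted.
  by apply: sub_sorted => i j /= ij; apply: sf.
have e : codom l = codom l'.
  apply: (irr_sorted_eq _ _ (srt _ st) (srt _ st')) => [x y z /= H1 H2|x /=|x].
    exact: ltn_trans H2 H1.
    exact: ltnn.
  apply/codomP/codomP => [[i ->]|[i ->]].
    by exists (t (s^-1%g i)); rewrite -h permKV.
  by exists (s (t^-1%g i)); rewrite h permKV.
have ll : l = l'.
  apply/ffunP => i; move: e; rewrite /codom /image_mem => /eq_in_map; apply.
  exact: mem_enum.
split=> //; apply/permP => i; apply/eqP; apply: contraT => ne.
have := h i; rewrite -ll => hi.
have {ne} : (s i < t i)%N || (t i < s i)%N by rewrite -neq_ltn.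
by case/orP => /(elimT (strictP l) st); rewrite hi ltnn.
Qed.

(** The product of the Leibniz terms of [s] and [t] is a signed monomial. It has all exponents [K]
    only if [l = l'] and [s = t], and then the two signs cancel, so each permutation contributes
    1. *)
Lemma mcoeff_alt_alt m K (l l' : {ffun 'I_m -> nat}) :
  strict l -> strict l' -> (forall j, l' j <= K)%N ->
  (alt (@xpow m) l * alt (@xcpow m K) l')@_[multinom K | _ < m] =
  if l == l' then (m`!)%:R else 0.
Proof.
move=> st st' lK; rewrite !alt_leibniz mulr_suml raddf_sum /=.
have E (s t : 'S_m) :
  ((-1) ^+ s * (\prod_i xpow i (l (s i))) *
   ((-1) ^+ t * (\prod_i xcpow K i (l' (t i)))))@_[multinom K | _ < m] =
  ((l == l') && (s == t))%:R.
  have -> : (-1) ^+ s * (\prod_i xpow i (l (s i))) *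
     ((-1) ^+ t * (\prod_i xcpow K i (l' (t i)))) =
     ((-1) ^+ (s (+) t)) *: 'X_[[multinom (l (s i) + (K - l' (t i)))%N | i < m]]
       :> {mpoly int[m]}.
    rewrite mulrACA -signr_addb -big_split /= -mul_mpolyC rmorph_sign; congr (_ * _).
    rewrite mpolyXE_id; apply: eq_bigr => i _.
    by rewrite mnmE /xpow /xcpow exprD.
  rewrite mcoeffZ mcoeffX.
  have -> : ([multinom (l (s i) + (K - l' (t i)))%N | i < m] == [multinom K | _ < m])
            = ((l == l') && (s == t)).
    apply/eqP/andP => [/mnmP h|[/eqP -> /eqP ->]].
      have [|-> ->] := strict_perm_eq st st' (s := s) (t := t); last by rewrite !eqxx.
      by move=> i; have := h i; rewrite !mnmE; have := lK (t i); lia.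
    by apply/mnmP => i; rewrite !mnmE subnKC.
  case: eqP => [_|]; last by rewrite mulr0.
  by case: eqP => [->|]; rewrite ?mulr0 // addbb mulr1.
under eq_bigr => s _.
  rewrite mulr_sumr raddf_sum /=.
  under eq_bigr => t _ do rewrite E.
  over.
case: eqP => _ /=; last by rewrite big1 // => s _; rewrite big1.
under eq_bigr => s _.
  rewrite (bigD1 s) //= eqxx big1 ?addr0; last by move=> t /negbTE; rewrite eq_sym => ->.
  over.
by rewrite sumr_const card_Sn.
Qed.

(** * The bialternant formula *)

Definition noninc N (l : 'I_N -> nat) := forall i j : 'I_N, (i <= j)%N -> (l j <= l i)%N.

Lemma det_sum_cols (R : comNzRingType) n (K : finType) (Q : 'I_n -> pred K)
    (F : 'I_n -> 'I_n -> K -> R) :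
  \det (\matrix_(i, j) \sum_(k | Q j k) F i j k) =
  \sum_(f : {ffun 'I_n -> K} | [forall j, Q j (f j)]) \det (\matrix_(i, j) F i j (f j)).
Proof.
rewrite -det_tr /determinant.
under eq_bigr => s _.
  under eq_bigr => i _ do rewrite 2!mxE.
  rewrite bigA_distr_big_dep mulr_sumr.
  over.
rewrite exchange_big /=; apply: eq_big => [f|f _].
  by apply/familyP/forallP.
rewrite -/(determinant _) -det_tr; apply: eq_bigr => s _; congr (_ * _).
by apply: eq_bigr => i _; rewrite !mxE.
Qed.

Lemma sum_geometric (R : comNzRingType) (x y : R) w a b e : (a <= b <= w)%N ->
  (x - y) * (\sum_(k < w.+1 | (a <= k <= b)%N) x ^+ (k + e) * y ^+ (b - k)) =
  x ^+ (b + e.+1) - x ^+ (a + e) * y ^+ (b.+1 - a).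
Proof.
move=> /andP[ab bw].
have -> : \sum_(k < w.+1 | (a <= k <= b)%N) x ^+ (k + e) * y ^+ (b - k) =
          \sum_(a <= k < b.+1) x ^+ (k + e) * y ^+ (b - k).
  rewrite big_geq_mkord /= (big_ord_widen_cond w.+1 (fun k => a <= k)%N
     (fun k => x ^+ (k + e) * y ^+ (b - k))) //.
rewrite mulr_sumr.
pose f k := x ^+ (k + e) * y ^+ (b.+1 - k).
have -> : \sum_(a <= k < b.+1) (x - y) * (x ^+ (k + e) * y ^+ (b - k)) =
          \sum_(a <= k < b.+1) (f k.+1 - f k).
  apply: eq_big_nat => k /andP[_ kb]; rewrite /f subSS subSn // addSn !exprS.
  ring.
rewrite telescope_sumr; last by lia.
by rewrite /f subnn expr0 mulr1 addSnnS.
Qed.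

Definition vpow (R : comNzRingType) N (v : nat -> R) (i : 'I_N) a := v i ^+ a.
Arguments vpow {R} N v.

(** Interlacing: [l / k] is a horizontal strip, the region that the largest entry may fill in a
    tableau of shape [l]. *)
Definition between N w (l : 'I_N.+1 -> nat) (k : {ffun 'I_N -> 'I_w.+1}) :=
  [forall i, (l (lift ord0 i) <= k i <= l (widen_ord (leqnSn N) i))%N].

(* Subtracting from each column a multiple of the next one clears the last row
   and makes the remaining entries divisible by [v i - v N]. *)
Lemma alt_branching (R : comNzRingType) (v : nat -> R) N w (l : 'I_N.+1 -> nat) :
  noninc l -> (forall i, (l i <= w)%N) ->
  alt (vpow N.+1 v) (fun j => l j + (N - j))%N =
  (\prod_(i < N) (v i - v N)) *
  \sum_(k : {ffun 'I_N -> 'I_w.+1} | between l k)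
    (alt (vpow N v) (fun j => k j + (N.-1 - j))%N *
     ((\prod_i v N ^+ (l (widen_ord (leqnSn N) i) - k i)) * v N ^+ l ord_max)).
Proof.
move=> nl lw.
pose M : 'M[R]_N.+1 := \matrix_(i, j) v i ^+ (l j + (N - j)).
pose wi := widen_ord (leqnSn N).
have wiE (j : 'I_N.+1) (jN : (j < N)%N) : j = wi (Ordinal jN) by apply: val_inj.
pose L j : nat := (l j + (N - j))%N.
pose nx (j : 'I_N.+1) : 'I_N.+1 := inord j.+1.
(* [U] is unitriangular and performs the column operations; the default value of [nx] at the last
   column is masked by the test [j < N]. *)
pose U : 'M[R]_N.+1 := \matrix_(i, j) ((i == j)%:R -
   ((j < N)%N && (i == nx j))%:R * v N ^+ (L j - L (nx j))).
have dU : \det U = 1.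
  rewrite det_trig.
    rewrite big1 // => i _; rewrite mxE eqxx.
    case: andP => [[lt /eqP e]|_]; last by rewrite mul0r subr0.
    by have := congr1 val e; rewrite /= inordK //; lia.
  apply/is_trig_mxP => i j ij; rewrite mxE.
  have -> : (i == j) = false by apply/eqP => e; rewrite e ltnn in ij.
  case: andP => [[lt /eqP e]|_]; last by rewrite mul0r subr0.
  by have := congr1 val e; rewrite /= inordK //; lia.
have MU i j : (M *m U) i j = if (j < N)%N
    then v i ^+ L j - v i ^+ L (nx j) * v N ^+ (L j - L (nx j)) else v i ^+ L j.
  rewrite mxE (bigD1 j) //= !mxE eqxx.
  case: ifP => jN /=.
    have nn : nx j != j.
      by apply/eqP => /(congr1 val) /=; rewrite inordK //; lia.
    rewrite (negbTE (_ : j != nx j)) 1?eq_sym // mul0r subr0 mulr1.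
    rewrite (bigD1 (nx j)) //= !mxE eqxx (negbTE nn) jN mul1r sub0r mulrN.
    rewrite big1 ?addr0 // => x /andP[/negbTE xj /negbTE xn].
    by rewrite !mxE xj xn jN /= mul0r subr0 mulr0.
  rewrite mul0r subr0 mulr1 big1 ?addr0 // => x /negbTE xj.
  by rewrite !mxE xj jN /= mul0r subr0 mulr0.
have -> : alt (vpow N.+1 v) (fun j => l j + (N - j))%N = \det (M *m U).
  by rewrite det_mulmx dU mulr1; congr (\det _); apply/matrixP=> i j; rewrite !mxE.
have MUin (i j : 'I_N) : (M *m U) (wi i) (wi j) =
   (v i - v N) * \sum_(k < w.+1 | (l (lift ord0 j) <= k <= l (wi j))%N)
        v i ^+ (k + (N.-1 - j)) * v N ^+ (l (wi j) - k).
  have jN := ltn_ord j.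
  have nxE : nx (wi j) = lift ord0 j by apply: val_inj; rewrite /= inordK.
  have le : (l (lift ord0 j) <= l (wi j))%N by apply: nl; rewrite /= /bump; lia.
  rewrite MU /= jN nxE sum_geometric ?le ?lw // /L /= /bump /=.
  by congr (_ ^+ _ - _ ^+ _ * _ ^+ _); lia.
have MUlast (j : 'I_N) : (M *m U) ord_max (wi j) = 0.
  have jN := ltn_ord j.
  have nxE : nx (wi j) = lift ord0 j by apply: val_inj; rewrite /= inordK.
  have le : (l (lift ord0 j) <= l (wi j))%N by apply: nl; rewrite /= /bump; lia.
  rewrite MU /= jN nxE -exprD subnKC ?subrr // /L /= /bump /=; lia.
(* Only the last entry of the last row survives. Each entry of the remaining minor is a geometric
   sum, and multilinearity in the columns collects these sums into one over [k]. *)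
rewrite (expand_det_row _ ord_max) big_ord_recr /= big1 ?add0r; last first.
  by move=> j _; rewrite MUlast mul0r.
rewrite MU /= ltnn /L subnn addn0 /cofactor -signr_odd addnn odd_double expr0 mul1r.
have -> : row' ord_max (col' ord_max (M *m U)) = \matrix_(i, j)
   \sum_(k < w.+1 | (l (lift ord0 j) <= k <= l (wi j))%N)
     ((v i - v N) * (v i ^+ (k + (N.-1 - j)) * v N ^+ (l (wi j) - k))).
  apply/matrixP => i j; rewrite 2!mxE [RHS]mxE -mulr_sumr -MUin.
  by congr ((M *m U) _ _); apply: val_inj; rewrite /= /bump leqNgt ltn_ord.
rewrite det_sum_cols !mulr_sumr; apply: eq_bigr => k _.
have -> : \det (\matrix_(i, j) ((v (i : 'I_N) - v N) * (v i ^+ (k j + (N.-1 - j)) *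
        v N ^+ (l (wi j) - k j)))) =
   (\prod_(i < N) (v i - v N)) * (alt (vpow N v) (fun j : 'I_N => k j + (N.-1 - j))%N *
      \prod_i v N ^+ (l (wi i) - k i)).
  rewrite alt_leibniz mulr_suml mulr_sumr; apply: eq_bigr => s _.
  rewrite [X in _ = _ * (_ * X)](reindex_inj (@perm_inj _ s)) /=.
  rewrite -mulrA mulrCA; congr (_ * _); rewrite -!big_split /=.
  by apply: eq_bigr => i _; rewrite mxE /vpow.
by rewrite mulrC -!mulrA.
Qed.

(* Tableaux with entries in [0, N) and at most N rows are encoded on a grid,
   the cells outside the shape [l] carrying the value [N]. *)
Definition tableau N w (l : 'I_N -> nat) (T : {ffun 'I_N * 'I_w -> 'I_N.+1}) : bool :=
  [&& [forall i, forall j : 'I_w, (T (i, j) < N)%N == (j < l i)%N],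
      [forall i, forall j : 'I_w, forall j' : 'I_w,
         (j < j')%N ==> (T (i, j) <= T (i, j'))%N]
    & [forall i : 'I_N, forall i' : 'I_N, forall j,
         (i < i')%N && (T (i', j) < N)%N ==> (T (i, j) < T (i', j))%N]].

Lemma tableauP N w (l : 'I_N -> nat) (T : {ffun 'I_N * 'I_w -> 'I_N.+1}) :
  reflect [/\ forall i j, (T (i, j) < N)%N = (j < l i)%N,
              forall i (j j' : 'I_w), (j < j')%N -> (T (i, j) <= T (i, j'))%N
            & forall (i i' : 'I_N) j, (i < i')%N -> (T (i', j) < N)%N ->
                (T (i, j) < T (i', j))%N]
          (tableau l T).
Proof.
apply: (iffP and3P) => [[h1 h2 h3]|[h1 h2 h3]]; split.
- by move=> i j; exact: (eqP (forallP (forallP h1 i) j)).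
- by move=> i j j'; exact: (implyP (forallP (forallP (forallP h2 i) j) j')).
- move=> i i' j lt1 lt2; apply: (implyP (forallP (forallP (forallP h3 i) i') j)).
  by rewrite lt1.
- by apply/'forall_forallP => i j; rewrite h1.
- by apply/forallP => i; apply/'forall_forallP => j j'; apply/implyP/h2.
- by apply/forallP => i; apply/'forall_forallP => i' j; apply/implyP => /andP[]; apply: h3.
Qed.

Lemma tableau_ge_row N w (l : 'I_N -> nat) (T : {ffun 'I_N * 'I_w -> 'I_N.+1})
    (i : 'I_N) (j : 'I_w) :
  tableau l T -> (i <= T (i, j))%N.
Proof.
case/tableauP => _ _ h.
have [lt|le] := ltnP (T (i, j)) N; last by apply: leq_trans le; apply: ltnW.
case: i lt => i iN; elim: i iN => // i IH iN lt.
have i'N : (i < N)%N by apply: ltnW.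
have lt1 := h (Ordinal i'N) (Ordinal iN) j (ltnSn i) lt.
exact: leq_ltn_trans (IH _ (ltn_trans lt1 lt)) lt1.
Qed.

Definition weight (R : comNzRingType) (v : nat -> R) N w
    (T : {ffun 'I_N * 'I_w -> 'I_N.+1}) : R :=
  \prod_i \prod_j (if (T (i, j) < N)%N then v (T (i, j)) else 1).

Lemma card_lt_ord w k : (k <= w)%N -> #|[pred x : 'I_w | x < k]%N| = k.
Proof. by move=> kw; rewrite -sum1_card /= (big_ord_narrow kw) sum1_card card_ord. Qed.

Lemma card_initial w (P : pred 'I_w) :
  (forall j j' : 'I_w, (j < j')%N -> P j' -> P j) -> forall j, P j = (j < #|P|)%N.
Proof.
move=> h j.
have [Pj|nPj] := boolP (P j); symmetry.
  rewrite -[X in (X <= _)%N](card_lt_ord (ltn_ord j)); apply: subset_leq_card.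
  apply/subsetP => x; rewrite !inE ltnS leq_eqVlt => /orP[/eqP/val_inj ->//|lt].
  exact: h Pj.
apply/negbTE; rewrite -leqNgt -[X in (_ <= X)%N](card_lt_ord (ltnW (ltn_ord j))).
apply: subset_leq_card; apply/subsetP => x Px; rewrite !inE ltnNge leq_eqVlt.
apply/negP => /orP[/eqP/val_inj e|lt]; first by apply: (negP nPj); rewrite e.
by apply: (negP nPj); exact: h lt Px.
Qed.

Local Notation wi := (widen_ord (leqnSn _)).

(* Branching: [tab_cut] removes the entries [N] from a tableau with entries in
   [0, N], recording the remaining shape; [tab_glue] puts them back. *)
Definition tab_glue N w (l : 'I_N.+1 -> nat)
    (p : {ffun 'I_N -> 'I_w.+1} * {ffun 'I_N * 'I_w -> 'I_N.+1}) :
    {ffun 'I_N.+1 * 'I_w -> 'I_N.+2} :=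
  [ffun x : 'I_N.+1 * 'I_w => inord (
     if (if insub (x.1 : nat) is Some i then (p.2 (i, x.2) : nat) else N) < N
     then (if insub (x.1 : nat) is Some i then (p.2 (i, x.2) : nat) else N)
     else if x.2 < l x.1 then N else N.+1)%N].

Definition tab_cut N w (T : {ffun 'I_N.+1 * 'I_w -> 'I_N.+2}) :
    {ffun 'I_N -> 'I_w.+1} * {ffun 'I_N * 'I_w -> 'I_N.+1} :=
  ([ffun i => inord #|[pred j | T (wi i, j) < N]%N|],
   [ffun x => inord (minn (T (wi x.1, x.2)) N)]).

Lemma tab_glueE N w (l : 'I_N.+1 -> nat)
    (p : {ffun 'I_N -> 'I_w.+1} * {ffun 'I_N * 'I_w -> 'I_N.+1}) (i : 'I_N) j :
  tab_glue l p (wi i, j) =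
  (if p.2 (i, j) < N then (p.2 (i, j) : nat) else if j < l (wi i) then N else N.+1)%N :> nat.
Proof.
rewrite ffunE /=; case: insubP => /= [i' _ e|]; last by rewrite ltn_ord.
have -> : i' = i by exact: ord_inj e.
by rewrite inordK //=; case: ifP => [?|_]; [lia|case: ifP; lia].
Qed.

Lemma tab_glueE_max N w (l : 'I_N.+1 -> nat)
    (p : {ffun 'I_N -> 'I_w.+1} * {ffun 'I_N * 'I_w -> 'I_N.+1}) j :
  tab_glue l p (ord_max, j) = (if j < l ord_max then N else N.+1)%N :> nat.
Proof.
rewrite ffunE /=; case: insubP => /= [i' _ e|_]; first by have := ltn_ord i'; rewrite e ltnn.
by rewrite ltnn inordK //=; case: ifP => _; lia.
Qed.

Lemma tab_cutE N w
    (T : {ffun 'I_N.+1 * 'I_w -> 'I_N.+2}) i j :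
  (tab_cut T).2 (i, j) = minn (T (wi i, j)) N :> nat.
Proof. by rewrite ffunE inordK // ltnS geq_minr. Qed.

Lemma tab_cutE1 N w
    (T : {ffun 'I_N.+1 * 'I_w -> 'I_N.+2}) i :
  (tab_cut T).1 i = #|[pred j | T (wi i, j) < N]%N| :> nat.
Proof. by rewrite ffunE inordK // ltnS -[X in (_ <= X)%N](card_ord w) max_card. Qed.

Lemma ord_recrP N (P : 'I_N.+1 -> Prop) : (forall i, P (wi i)) -> P ord_max -> forall i, P i.
Proof.
move=> h1 h2 i; have [iN|iN] := ltnP i N.
  by have -> : i = wi (Ordinal iN) by apply: val_inj.
by have -> // : i = ord_max; apply: val_inj => /=; have := ltn_ord i; lia.
Qed.

Lemma tab_cutK N w (l : 'I_N.+1 -> nat)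
    (T : {ffun 'I_N.+1 * 'I_w -> 'I_N.+2}) :
  tableau l T -> tab_glue l (tab_cut T) = T.
Proof.
move=> tT; have ge := tableau_ge_row _ _ tT; case/tableauP: tT => h1 _ _.
apply/ffunP => -[i j]; apply: val_inj => /=; have := h1 i j.
have := ltn_ord (T (i, j)).
elim/ord_recrP: i => [i|]; last first.
  rewrite tab_glueE_max; have := ge ord_max j => /=.
  by case: ifP => _; lia.
rewrite tab_glueE !tab_cutE => lt <-; move: lt; move: (nat_of_ord (T _)) => t lt.
by case: ifP => ?; [|case: ifP => ?]; lia.
Qed.

Definition tab_pair N w (l : 'I_N.+1 -> nat)
    (p : {ffun 'I_N -> 'I_w.+1} * {ffun 'I_N * 'I_w -> 'I_N.+1}) :=
  between l p.1 && tableau (fun i => p.1 i : nat) p.2.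

Lemma tab_cut_pair N w (l : 'I_N.+1 -> nat)
    (T : {ffun 'I_N.+1 * 'I_w -> 'I_N.+2}) :
  (forall i, l i <= w)%N -> tableau l T -> tab_pair l (tab_cut T).
Proof.
move=> lw /tableauP[h1 h2 h3].
(* Rows increase weakly, so the entries below [N] form an initial segment, whose length is the
   recorded [k i]. *)
have ini i j : (T (wi i, j) < N)%N = (j < (tab_cut T).1 i)%N.
  rewrite tab_cutE1; apply: (@card_initial w [pred j | T (wi i, j) < N]%N) => x y xy /=.
  by apply: leq_ltn_trans; apply: h2.
have k_le i : ((tab_cut T).1 i <= w)%N by rewrite -ltnS ltn_ord.
apply/andP; split.
  apply/forallP => i; apply/andP; split; rewrite leqNgt; apply/negP => lt.
    (* Otherwise the cell of row [i + 1] in column [k i] would hold an entry at most [N] under an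
       entry at least [N], against column strictness. *)
    have jw : ((tab_cut T).1 i < w)%N by apply: leq_trans lt (lw _).
    have := h1 (lift ord0 i) (Ordinal jw); rewrite /= lt => lt1.
    have := h3 (wi i) (lift ord0 i) (Ordinal jw); rewrite lt1 /= /bump leq0n add1n.
    rewrite ltnSn => /(_ isT isT) lt2; have := ini i (Ordinal jw).
    by rewrite /= ltnn; lia.
  have jw : (l (wi i) < w)%N by apply: leq_trans lt (k_le i).
  have := h1 (wi i) (Ordinal jw); have := ini i (Ordinal jw).
  by rewrite /= lt ltnn; lia.
apply/tableauP; split=> [i j|i j j' jj|i i' j ii].
- by rewrite tab_cutE -ini; case: (ltnP (T (wi i, j)) N); lia.
- by rewrite !tab_cutE leq_min geq_minr andbT;
     exact: leq_trans (geq_minl _ _) (h2 (wi i) _ _ jj).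
- rewrite !tab_cutE => lt; have := h3 (wi i) (wi i') j ii; lia.
Qed.

Lemma tab_glue_tableau N w (l : 'I_N.+1 -> nat)
    (p : {ffun 'I_N -> 'I_w.+1} * {ffun 'I_N * 'I_w -> 'I_N.+1}) :
  noninc l -> tab_pair l p -> tableau l (tab_glue l p).
Proof.
move=> nl /andP[/forallP b /tableauP[h1' h2 h3]].
have h1 i j : (p.2 (i, j) < N)%N = (j < p.1 i)%N := h1' i j.
apply/tableauP; split=> [i j|i j j' jj|i i' j].
- elim/ord_recrP: i => [i|]; last first.
    by rewrite tab_glueE_max; case: ifP => _; rewrite ?ltnSn ?ltnn.
  rewrite tab_glueE; case: ifP => lt.
    rewrite (ltn_trans lt (ltnSn N)); symmetry; rewrite h1 in lt.
    by case/andP: (b i) => _; apply: leq_trans lt.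
  by case: ifP => _; rewrite ?ltnSn ?ltnn.
- elim/ord_recrP: i => [i|]; last first.
    rewrite !tab_glueE_max; case: ifP => ?; case: ifP => ? //; lia.
  rewrite !tab_glueE; have := h2 i _ _ jj.
  move: (nat_of_ord (p.2 (i, j))) (nat_of_ord (p.2 (i, j'))) => x y.
  by do ![case: ifP => ?] => //; lia.
(* All cells above a cell of row [i'] carry entries below [N], since [l i' <= l (x + 1) <= k x] for
   every earlier row [x]. *)
have aux (x : 'I_N) : (x < i')%N -> (j < l i')%N -> (p.2 (x, j) < N)%N.
  move=> xi jl; rewrite h1; apply: leq_trans jl _.
  case/andP: (b x) => H _; apply: leq_trans H; apply: nl => /=; rewrite /bump; lia.
elim/ord_recrP: i => [i|]; last by have := ltn_ord i'; rewrite /=; lia.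
elim/ord_recrP: i' aux => [i'|] aux lt; last first.
  rewrite tab_glueE_max; case: ifP => jl; last by rewrite ltnn.
  by have lx := aux i lt jl; rewrite tab_glueE lx.
rewrite !tab_glueE; case: (ltnP (p.2 (i', j)) N) => [lt' _|ge].
  by have lx := h3 i i' j lt lt'; rewrite (ltn_trans lx lt').
case: ifP => jl; last by rewrite ltnn.
by have lx := aux i lt jl; rewrite lx.
Qed.

Lemma tab_glueK N w (l : 'I_N.+1 -> nat)
    (p : {ffun 'I_N -> 'I_w.+1} * {ffun 'I_N * 'I_w -> 'I_N.+1}) :
  tab_pair l p -> tab_cut (tab_glue l p) = p.
Proof.
case: p => k T; move=> /andP[_ /tableauP[h1 _ _]].
have lt i j : (tab_glue l (k, T) (wi i, j) < N)%N = (j < k i)%N.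
  by rewrite tab_glueE /= -h1; case: ifP => //; case: ifP; lia.
rewrite [LHS]surjective_pairing; congr (_, _).
  apply/ffunP => i; apply: val_inj; rewrite [LHS]tab_cutE1.
  rewrite (eq_card (_ : _ =i [pred j : 'I_w | j < k i]%N)) ?card_lt_ord //.
    by rewrite -ltnS ltn_ord.
  by move=> j; rewrite !inE lt.
apply/ffunP => -[i j]; apply: val_inj; rewrite [LHS]tab_cutE tab_glueE /=.
have := ltn_ord (T (i, j)); move: (nat_of_ord (T (i, j))) => t.
by case: ifP => ?; [|case: ifP => ?]; lia.
Qed.

Lemma prod_between (R : comNzRingType) w (x : R) a b : (b <= w)%N ->
  \prod_(j < w) (if (a <= j < b)%N then x else 1) = x ^+ (b - a).
Proof.
move=> bw; rewrite -big_mkcond /= prodr_const; congr (_ ^+ _).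
have [ab|ba] := leqP a b; last first.
  by rewrite (eq_card0 (_ : _ =i pred0)); [lia|move=> j; rewrite !inE; lia].
have e1 : #|[predI [pred j : 'I_w | j < b]%N & [pred j : 'I_w | j < a]%N]| = a.
  rewrite -[RHS](card_lt_ord (leq_trans ab bw)); apply: eq_card => j.
  by rewrite !inE; lia.
apply: (@addnI a); rewrite subnKC // -[RHS](card_lt_ord bw).
rewrite -[RHS](cardID [pred j : 'I_w | j < a]%N) e1; congr (_ + _)%N.
by apply: eq_card => j; rewrite !inE -leqNgt.
Qed.

Lemma weight_glue (R : comNzRingType) (v : nat -> R) N w (l : 'I_N.+1 -> nat)
    (p : {ffun 'I_N -> 'I_w.+1} * {ffun 'I_N * 'I_w -> 'I_N.+1}) :
  noninc l -> (forall i, l i <= w)%N -> tab_pair l p ->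
  weight v (tab_glue l p) = weight v p.2 *
    ((\prod_i v N ^+ (l (wi i) - p.1 i)) * v N ^+ l ord_max).
Proof.
move=> nl lw /andP[/forallP b /tableauP[h1' _ _]].
have h1 i j : (p.2 (i, j) < N)%N = (j < p.1 i)%N := h1' i j.
rewrite /weight big_ord_recr /= mulrA -big_split /=; congr (_ * _); last first.
  rewrite -[X in _ ^+ X]subn0 -(@prod_between _ w) //; apply: eq_bigr => j _.
  by rewrite tab_glueE_max; case: (ltnP j (l ord_max)) => _; rewrite ?ltnSn ?ltnn.
apply: eq_bigr => i _; rewrite -(@prod_between _ w) // -big_split /=; apply: eq_bigr => j _.
have := h1 i j; have := b i; rewrite !tab_glueE.
case: (ltnP (p.2 (i, j)) N) => [lt bi /esym e|le bi /esym e].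
  by rewrite (ltn_trans lt) // [(p.1 i <= j)%N]leqNgt e mulr1.
rewrite [(p.1 i <= j)%N]leqNgt e /= mul1r.
by case: (ltnP j (l _)) => _; rewrite ?ltnSn ?ltnn.
Qed.

Definition tabsum (R : comNzRingType) (v : nat -> R) N w (l : 'I_N -> nat) : R :=
  \sum_(T : {ffun 'I_N * 'I_w -> 'I_N.+1} | tableau l T) weight v T.

Lemma tabsum_branching (R : comNzRingType) (v : nat -> R) N w (l : 'I_N.+1 -> nat) :
  noninc l -> (forall i, l i <= w)%N ->
  tabsum v w l = \sum_(k : {ffun 'I_N -> 'I_w.+1} | between l k)
    (tabsum v w (fun i => k i : nat) *
     ((\prod_i v N ^+ (l (widen_ord (leqnSn N) i) - k i)) * v N ^+ l ord_max)).
Proof.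
move=> nl lw; under [RHS]eq_bigr do rewrite mulr_suml.
rewrite [RHS]pair_big_dep /= /tabsum (reindex_onto (tab_glue l) (@tab_cut N w)) /=; last first.
  by move=> T; apply: tab_cutK.
apply: eq_big => [p|p].
  apply/andP/idP => [[t /eqP <-]|tp].
    exact: tab_cut_pair.
  by rewrite tab_glueK // tab_glue_tableau.
case/andP=> t /eqP e; apply: weight_glue => //.
by rewrite -e; apply: tab_cut_pair.
Qed.

(** Both sides obey the same branching recursion in the number of variables, the Vandermonde
    determinant absorbing the factors [v i - v N]. *)
Lemma alt_tabsum (R : comNzRingType) (v : nat -> R) N w (l : 'I_N -> nat) :
  noninc l -> (forall i, l i <= w)%N ->
  alt (vpow N v) (fun j => N.-1 - j)%N * tabsum v w l =
  alt (vpow N v) (fun j => l j + (N.-1 - j))%N.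
Proof.
elim: N l => [|N IH] l nl lw.
  rewrite /alt !det_mx00 mul1r /tabsum.
  rewrite (big_pred1 [ffun _ => ord0]) => [|T]; first by rewrite /weight big_ord0.
  have -> : T = [ffun _ => ord0] by apply/ffunP => -[[]].
  by rewrite /= eqxx; apply/tableauP; split=> -[].
rewrite /= (alt_branching v nl lw) (tabsum_branching v nl lw).
(* The Vandermonde recursion is the branching of the zero shape, where [k = 0] is the only term. *)
have nz : noninc (fun _ : 'I_N.+1 => 0%N) by [].
have -> : alt (vpow N.+1 v) (fun j => N - j)%N =
   (\prod_(i < N) (v i - v N)) * alt (vpow N v) (fun j => N.-1 - j)%N.
  rewrite -(eq_alt _ (l := fun j => (0 + (N - j))%N)) //.
  rewrite (alt_branching v (w := 0) nz) // (big_pred1 [ffun _ => ord0]) => [|k].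
    congr (_ * _); rewrite expr0 mulr1 big1 ?mulr1 => [|i _]; last by [].
    by apply: eq_alt => j; rewrite ffunE.
  have -> : k = [ffun _ => ord0] by apply/ffunP => i; rewrite ffunE; apply: ord1.
  by rewrite /= eqxx; apply/forallP => i; rewrite ffunE.
rewrite -mulrA; congr (_ * _); rewrite mulr_sumr; apply: eq_bigr => k /forallP b.
rewrite mulrA IH // => [i j|i]; last by rewrite -ltnS ltn_ord.
rewrite leq_eqVlt => /orP[/eqP/val_inj -> //|ij].
case/andP: (b i) => H _; case/andP: (b j) => _ H'; apply: leq_trans H' (leq_trans _ H).
by apply: nl; rewrite /= /bump; lia.
Qed.

(** * Schur polynomials as sums over grids *)

Lemma prod_box (R : comNzRingType) la N w (F : nat -> nat -> R) :
  (size la <= N)%N -> (forall i, nth 0%N la i <= w)%N ->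
  \prod_(b : box la) F (brow b) (bcol b) =
  \prod_(i < N) \prod_(j < w) (if (j < nth 0%N la i)%N then F i j else 1).
Proof.
move=> sN lw.
transitivity (\prod_(i < size la) \prod_(j < nth 0%N la i) F i j).
  symmetry; exact: (@sig_big_dep _ _ _ _ (fun i : 'I_(size la) => 'I_(nth 0%N la i))
    xpredT (fun _ => xpredT) (fun i j => F i j)).
rewrite (big_ord_widen N (fun i => \prod_(j < nth 0%N la i) F i j)) // big_mkcond /=.
apply: eq_bigr => i _; case: ltnP => [lt|le].
  by rewrite (big_ord_widen w (fun j => F i j)) // -big_mkcond.
by rewrite big1 // => j _; rewrite nth_default.
Qed.

Lemma box_inj la (b b' : box la) : brow b = brow b' -> bcol b = bcol b' -> b = b'.
Proof.
case: b b' => [i j] [i' j']; rewrite /brow /bcol /= => /ord_inj e.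
by subst i'; move/ord_inj ->.
Qed.

Lemma box_ex la i j : (j < nth 0%N la i)%N -> exists b : box la, brow b = i /\ bcol b = j.
Proof.
move=> ji; have il : (i < size la)%N.
  by rewrite ltnNge; apply/negP => le; rewrite nth_default in ji.
by exists (existT _ (Ordinal il) (Ordinal (ji : (j < nth 0%N la (Ordinal il))%N))).
Qed.

Lemma bcol_lt la (b : box la) : (bcol b < nth 0%N la (brow b))%N.
Proof. by case: b => i j; apply: ltn_ord. Qed.

Lemma brow_lt la (b : box la) : (brow b < size la)%N.
Proof. by case: b => i j; apply: ltn_ord. Qed.

Definition box_of_grid la n w (T : {ffun 'I_n.+1 * 'I_w.+1 -> 'I_n.+2}) :
    {ffun box la -> 'I_n.+1} :=
  [ffun b => inord (T (inord (brow b), inord (bcol b)))].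

Definition grid_of_box la n w (S : {ffun box la -> 'I_n.+1}) :
    {ffun 'I_n.+1 * 'I_w.+1 -> 'I_n.+2} :=
  [ffun x : 'I_n.+1 * 'I_w.+1 =>
     if [pick b : box la | (brow b == x.1 :> nat) && (bcol b == x.2 :> nat)] is Some b
     then inord (S b) else ord_max].

Lemma grid_of_boxE la n w (S : {ffun box la -> 'I_n.+1}) (i : 'I_n.+1) (j : 'I_w.+1) b :
  brow b = i -> bcol b = j -> grid_of_box w S (i, j) = S b :> nat.
Proof.
move=> ei ej; rewrite ffunE /=; case: pickP => [b' /andP[/eqP e1 /eqP e2]|/(_ b)].
  have -> : b' = b by apply: box_inj; rewrite ?e1 ?e2.
  by rewrite inordK // ltnS ltnW.
by rewrite ei ej !eqxx.
Qed.

Lemma grid_of_box_out la n w (S : {ffun box la -> 'I_n.+1}) (i : 'I_n.+1) (j : 'I_w.+1) :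
  (nth 0%N la i <= j)%N -> grid_of_box w S (i, j) = n.+1 :> nat.
Proof.
move=> le; rewrite ffunE /=; case: pickP => [b /andP[/eqP e1 /eqP e2]|] //.
by have := bcol_lt b; rewrite e1 e2 ltnNge le.
Qed.

Lemma schur_tabsum la n w :
  (forall i j, i <= j -> nth 0%N la j <= nth 0%N la i)%N ->
  (size la <= n.+1)%N -> (forall i, nth 0%N la i <= w.+1)%N ->
  schur la n.+1 = tabsum (fun a => 'X_(inord a)) w.+1 (fun i : 'I_n.+1 => nth 0%N la i).
Proof.
move=> nl sn lw.
have bi (b : box la) : (inord (brow b) : 'I_n.+1) = brow b :> nat.
  by rewrite inordK // (leq_trans (brow_lt b)).
have bj (b : box la) : (inord (bcol b) : 'I_w.+1) = bcol b :> nat.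
  by rewrite inordK // (leq_trans (bcol_lt b)).
pose l (i : 'I_n.+1) := nth 0%N la i.
have inT (S : {ffun box la -> 'I_n.+1}) i j :
    (grid_of_box w S (i, j) < n.+1)%N = (j < nth 0%N la i)%N.
  have [lt|le] := ltnP j (nth 0%N la i); last by rewrite grid_of_box_out // ltnn.
  by have [b [e1 e2]] := box_ex lt; rewrite (grid_of_boxE S e1 e2) ltn_ord.
have K1 T : tableau l T -> grid_of_box w (box_of_grid la T) = T.
  case/tableauP => h1 _ _; apply/ffunP => -[i j]; apply: ord_inj.
  have [lt|le] := ltnP j (nth 0%N la i); last first.
    rewrite grid_of_box_out //; have := h1 i j; rewrite /l [(j < _)%N]ltnNge le /=.
    by move/negbT; have := ltn_ord (T (i, j)); move: (nat_of_ord (T _)) => t; lia.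
  have [b [e1 e2]] := box_ex lt; rewrite (grid_of_boxE _ e1 e2) ffunE.
  have -> : inord (brow b) = i by apply: ord_inj; rewrite bi.
  have -> : inord (bcol b) = j by apply: ord_inj; rewrite bj.
  by rewrite inordK // h1.
have K2 (S : {ffun box la -> 'I_n.+1}) : box_of_grid la (grid_of_box w S) = S.
  apply/ffunP => b; apply: ord_inj; rewrite ffunE.
  by rewrite (grid_of_boxE S (esym (bi b)) (esym (bj b))) inord_val.
have SS (S : {ffun box la -> 'I_n.+1}) : tableau l (grid_of_box w S) = semistandard S.
  apply/tableauP/forallP => [[h1 h2 h3] b|h].
    apply/forallP => b'; have EE := grid_of_boxE S (esym (bi _)) (esym (bj _)).
    rewrite -!EE; apply/andP; split; apply/implyP => /andP[/eqP e lt].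
      have -> : inord (brow b') = inord (brow b) :> 'I_n.+1 by rewrite e.
      by apply: h2; rewrite !bj.
    have -> : inord (bcol b') = inord (bcol b) :> 'I_w.+1 by rewrite e.
    by apply: h3; rewrite ?bi // inT bi bj e bcol_lt.
  split=> [i j|i j j' jj|i i' j ii]; first exact: inT.
    have [lt|le] := ltnP j' (nth 0%N la i); last first.
      by rewrite [X in (_ <= X)%N]grid_of_box_out // -ltnS ltn_ord.
    have [b [e1 e2]] := box_ex (ltn_trans jj lt); have [b' [e1' e2']] := box_ex lt.
    rewrite (grid_of_boxE S e1 e2) (grid_of_boxE S e1' e2').
    have /forallP/(_ b')/andP[/implyP H _] := h b.
    by apply: H; rewrite e1 e1' e2 e2' eqxx jj.
  rewrite inT => lt; have lt' : (j < nth 0%N la i)%N by apply: leq_trans lt (nl _ _ (ltnW ii)).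
  have [b [e1 e2]] := box_ex lt'; have [b' [e1' e2']] := box_ex lt.
  rewrite (grid_of_boxE S e1 e2) (grid_of_boxE S e1' e2').
  have /forallP/(_ b')/andP[_ /implyP H] := h b.
  by apply: H; rewrite e1 e1' e2 e2' eqxx ii.
rewrite /tabsum (reindex_onto (@grid_of_box la n w) (@box_of_grid la n w)) /=; last first.
  by move=> T /K1.
apply: eq_big => [S|S _]; first by rewrite K2 eqxx andbT SS.
rewrite /weight.
pose F i j : {mpoly int[n.+1]} := 'X_(inord (grid_of_box w S (inord i, inord j))).
transitivity (\prod_(b : box la) F (brow b) (bcol b)).
  apply: eq_bigr => b _.
  by rewrite /F (grid_of_boxE S (esym (bi b)) (esym (bj b))) inord_val.
rewrite (prod_box F sn lw); apply: eq_bigr => i _; apply: eq_bigr => j _.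
by rewrite inT /F !inord_val.
Qed.

Lemma is_part_nth la i j : sorted geq la -> (i <= j)%N -> (nth 0%N la j <= nth 0%N la i)%N.
Proof.
move=> sl ij; have [jl|jl] := ltnP j (size la); last by rewrite nth_default.
apply: (sorted_leq_nth _ _ _ sl) => //; first by move=> x y z /= H1 H2; apply: leq_trans H2 H1.
  by move=> x; apply: leqnn.
by rewrite inE; apply: leq_ltn_trans jl.
Qed.

Lemma alt_schur la n : sorted geq la -> (size la <= n.+1)%N ->
  alt (@xpow n.+1) (fun j => n - j)%N * schur la n.+1 =
  alt (@xpow n.+1) (fun j => nth 0%N la j + (n - j))%N.
Proof.
move=> sl sn; have nl i j := is_part_nth (i := i) (j := j) sl.
rewrite (schur_tabsum (w := nth 0%N la 0) nl sn) => [|i]; last exact/leqW/nl.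
pose v a : {mpoly int[n.+1]} := 'X_(inord a).
have E l : alt (@xpow n.+1) l = alt (vpow n.+1 v) l.
  by congr (\det _); apply/matrixP => i j; rewrite !mxE /xpow /vpow /v inord_val.
rewrite !E; apply: (alt_tabsum v (N := n.+1)) => [i j|i]; first exact: nl.
exact/leqW/nl.
Qed.

(** Columns increase strictly, so the first one would need more than [n] distinct values. *)
Lemma schur_eq0 la n : is_part la -> (n < size la)%N -> schur la n = 0.
Proof.
move=> /andP[sl n0] lt; rewrite /schur big_pred0 // => T; apply/negP => /forallP h.
have pos i : (i < size la)%N -> (0 < nth 0%N la i)%N.
  by move=> il; rewrite lt0n; apply/eqP => e; move: n0; rewrite -e mem_nth.
have ge i : (i < size la)%N -> forall b : box la, brow b = i -> bcol b = 0%N -> (i <= T b)%N.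
  elim: i => // i IH il b e1 e2.
  have [b' [e1' e2']] := box_ex (pos _ (ltnW il)).
  apply: leq_ltn_trans (IH (ltnW il) _ e1' e2') _.
  have /forallP/(_ b)/andP[_ /implyP H] := h b'.
  by apply: H; rewrite e1 e2 e1' e2' eqxx ltnSn.
have [b [e1 e2]] := box_ex (pos _ lt).
by have := ge _ lt b e1 e2; rewrite leqNgt ltn_ord.
Qed.

(** * Combinatorics of strips *)

Local Close Scope ring_scope.

Definition transpose_of (p p' : nat -> nat) := forall i j, (j < p' i) = (i < p j).

(* A partition [kappa] reached from [p'] by a vertical strip of size [q] followed
   by [k] boxes, and from [p] by a horizontal strip of size [q] followed by [k]
   boxes. *)
Definition fillable m (p p' : nat -> nat) q k := exists kappa t1 t2 : nat -> nat,
  [/\ forall j, kappa j.+1 <= kappa j, forall j, t1 j.+1 <= t1 j,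
      forall j, [&& p' j <= t1 j, t1 j <= (p' j).+1 & t1 j <= kappa j],
      forall j, [&& p j <= t2 j, t2 j <= kappa j & t2 j.+1 <= p j]
    & [/\ \sum_(j < m) kappa j = \sum_(j < m) p j + q + k,
          \sum_(j < m) t1 j = \sum_(j < m) p' j + q
        & \sum_(j < m) t2 j = \sum_(j < m) p j + q]].

(* The number of boxes of [kappa / p] in row [j] that are topmost in their column. *)
Definition new_cols (p kappa : nat -> nat) j :=
  (if j is i.+1 then minn (kappa j) (p i) else kappa j) - p j.

(** The conditions are necessary for a common [kappa]: a vertical strip of size [q] meets [q] rows
    of [kappa / p'], and a horizontal strip of size [q] meets [q] columns of [kappa / p] in their
    topmost boxes. *)
Definition obstructed m (p p' : nat -> nat) q k := forall kappa : nat -> nat,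
  (forall j, j < m -> maxn (p j) (p' j) <= kappa j) ->
  \sum_(j < m) kappa j = \sum_(j < m) p j + q + k ->
  q <= \sum_(j < m) (p' j < kappa j) -> q <= \sum_(j < m) new_cols p kappa j -> False.

Lemma sum_indicator m x y : y <= m -> \sum_(j < m) (x <= j < y) = y - x.
Proof.
move=> ym; transitivity (\sum_(0 <= j < m | (x <= j) && (j < y)) 1).
  by rewrite [RHS]big_mkcond big_mkord; apply: eq_bigr => j _; case: ifP.
by rewrite -big_nat_widen // -[RHS]muln1 -sum_nat_const_nat [RHS](big_nat_widenl x 0).
Qed.

Lemma sum_eq_pointwise m (f g : nat -> nat) : (forall j, j < m -> f j <= g j) ->
  \sum_(j < m) g j <= \sum_(j < m) f j -> forall j, j < m -> f j = g j.
Proof.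
move=> fg le j jm.
have /leqif_sum : forall i : 'I_m, true -> f i <= g i ?= iff (f i == g i).
  by move=> i _; apply/leqif_eq/fg.
case=> le1; rewrite eqn_leq le1 le => /esym/forallP/(_ (Ordinal jm)).
by move/eqP.
Qed.

(** Both strips are empty and all boxes are added singly. *)
Lemma fillable_union m (p p' : nat -> nat) :
  (forall j, p j.+1 <= p j) -> (forall j, p' j.+1 <= p' j) ->
  fillable m p p' 0 (\sum_(j < m) maxn (p j) (p' j) - \sum_(j < m) p j).
Proof.
move=> np np'; exists (fun j => maxn (p j) (p' j)), p', p; split=> // [j|j|j|].
- by have := np j; have := np' j; lia.
- by lia.
- by have := np j; lia.
split; rewrite ?addn0 // subnKC //; apply: leq_sum => j _; lia.
Qed.

(** The new box [(r, p r)] of [P] reappears in [P'] as [(p r, r)]. Both lie outside the union of [p]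
    and [p'] because [p r < a <= r], and they are distinct, so the union grows by two while the size
    allowed for [kappa] grows by one. *)
Lemma obstructed_outside m a r (p p' P P' : nat -> nat) :
  (forall j, p j <= a) -> p r < a <= r -> r < m ->
  (forall j, P j = p j + (j == r)) -> transpose_of p p' -> transpose_of P P' ->
  obstructed m P P' 0 (\sum_(j < m) maxn (p j) (p' j) - \sum_(j < m) p j).
Proof.
move=> pa /andP[pra ar] rm Pp cp cP kappa le sk _ _.
have SP : \sum_(j < m) P j = \sum_(j < m) p j + 1.
  rewrite (eq_bigr (fun j : 'I_m => p j + (r <= j < r.+1))) => [|j _].
    by rewrite big_split /= sum_indicator // subSnn.
  by rewrite Pp; congr (_ + nat_of_bool _); lia.
have le0 : \sum_(j < m) p j <= \sum_(j < m) maxn (p j) (p' j).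
  by apply: leq_sum => j _; lia.
have : \sum_(j < m) (maxn (p j) (p' j) + (r <= j < r.+1) + (p r <= j < (p r).+1)) <=
       \sum_(j < m) kappa j.
  apply: leq_sum => j _; apply: leq_trans (le _ (ltn_ord j)).
  have p'P' i : p' i <= P' i.
    rewrite leqNgt; apply/negP => lt.
    have := cp i (P' i); have := cP i (P' i); rewrite lt ltnn Pp; lia.
  have [->|jr] := eqVneq (j : nat) r.
    have p'r : p' r = 0.
      by apply/eqP; rewrite -leqn0 leqNgt (cp r 0) -leqNgt; apply: leq_trans (pa 0) ar.
    by rewrite Pp eqxx p'r; lia.
  have [->|jc] := eqVneq (j : nat) (p r).
    have l1 : r < P' (p r) by rewrite cP Pp eqxx addn1.
    have l2 : p' (p r) <= r by rewrite leqNgt cp ltnn.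
    have := pa (p r); lia.
  have := p'P' j; rewrite Pp; lia.
rewrite sk !big_split /= !sum_indicator //; last by lia.
rewrite SP; move: le0; move: (\sum_(j < m) p j) (\sum_(j < m) maxn (p j) (p' j)); lia.
Qed.

Definition kappa_corner a t (p p' : nat -> nat) j :=
  if j == 0 then (a + t).+1 else if j == a.-1 then a else
  if j == a + t then 1 else maxn (p j) (p' j).

Lemma conjugate_ge p p' : transpose_of p p' -> forall i j, i < p j -> j < p' i.
Proof. by move=> c i j; rewrite c. Qed.

Lemma conjugate_le p p' : transpose_of p p' -> forall i j, p j <= i -> p' i <= j.
Proof. by move=> c i j le; rewrite leqNgt c -leqNgt. Qed.

Lemma conjugate_noninc p p' : transpose_of p p' -> forall i, p' i.+1 <= p' i.
Proof.
move=> c i; rewrite leqNgt; apply/negP => lt.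
by move: (lt); rewrite c => /ltnW; rewrite -c ltnn.
Qed.

(* The extra boxes are the three corners [(0, a + t)], [(a - 1, a - 1)] and
   [(a + t, 0)] of the union of the diagram and its transpose. *)
Lemma fillable_corner m a b t (p p' : nat -> nat) :
  a + t < m -> 0 < b < a -> (forall i, i < a.-1 -> p i = a) -> p a.-1 = b ->
  (forall i, a <= i < a + t -> 0 < p i) -> (forall i, a + t <= i -> p i = 0) ->
  (forall j, p j.+1 <= p j) -> transpose_of p p' ->
  let q := (a.-1 - b + t + 3) in
  fillable m p p' q (\sum_(j < m) kappa_corner a t p p' j - \sum_(j < m) p j - q) /\
  \sum_(j < m) p j + q <= \sum_(j < m) kappa_corner a t p p' j.
Proof.
move=> atm /andP[b0 ba] pl pb pt p0 np cp q.
have np' := conjugate_noninc cp.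
have ge := conjugate_ge cp; have le := conjugate_le cp.
have p00 : p 0 = a by apply: pl; lia.
have p'0 : p' 0 = a + t.
  have : p' 0 <= a + t by apply: le; rewrite p0.
  have : (a + t).-1 < p' 0.
    apply: ge; have [->|t0] := posnP t; first by rewrite addn0 pb.
    by apply: pt; lia.
  lia.
have p'1 i : i < b -> a <= p' i.
  by move=> ib; have := ge i a.-1; rewrite pb; lia.
have p'2 i : b <= i < a -> p' i = a.-1.
  move=> /andP[bi ia]; have := ge i a.-2; rewrite pl; last by lia.
  by have := le i a.-1; rewrite pb => H1 H2; have := H1 bi; have := H2 ia; lia.
have p'3 i : a <= i -> p' i = 0.
  by move=> ai; have := le i 0; rewrite p00 => /(_ ai); lia.
have pab i : a.-1 <= i -> p i <= b.
  elim: i => [|i IH]; first by rewrite leqn0 => /eqP e; rewrite -pb e.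
  by rewrite leq_eqVlt => /orP[/eqP <-|/IH]; [rewrite pb|apply: leq_trans].
pose kappa := kappa_corner a t p p'.
(* The rows fall into zones: the top row, the rows where [p'] dominates, the rows filled up to
   length [a], and the tail of [p] followed by the corner in row [a + t]. *)
have kE j : [\/ j = 0 /\ kappa j = (a + t).+1, 0 < j < b /\ kappa j = p' j,
    b <= j < a /\ kappa j = a |
    (a <= j < a + t /\ kappa j = p j) \/ (j = a + t /\ kappa j = 1) \/
    (a + t < j /\ kappa j = 0)].
  rewrite /kappa /kappa_corner; have [->|j0] := eqVneq j 0; first by constructor 1.
  have [->|ja] := eqVneq j a.-1; first by constructor 3; split=> //; lia.
  have [->|jat] := eqVneq j (a + t); first by constructor 4; right; left.
  have [jb|bj] := ltnP j b.
    constructor 2; split; first by lia.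
    by have := p'1 j jb; rewrite pl; lia.
  have [ja1|a1j] := ltnP j a.-1.
    constructor 3; split=> //; try lia.
    by rewrite pl // p'2; lia.
  constructor 4; rewrite p'3 ?maxn0; last by lia.
  have [lt|gt] := ltnP j (a + t); first by left; split=> //; lia.
  by right; right; split; [lia|apply: p0; lia].
(* [t1] adds one box in each nonempty row of [kappa / p'], and [t2] the topmost box in each nonempty
   column of [kappa / p]. There are [q] of each: by rows [1 + (a.-1 - b) + 1 + t + 1], by columns
   [t.+1 + (a - b) + 1]. *)
pose t1 j := minn (kappa j) (p' j).+1.
pose t2 j := if j is i.+1 then minn (kappa j) (p i) else kappa j.
have t1E j : t1 j = p' j + ((0 <= j < 1) + (b <= j < a.-1) + (a.-1 <= j < a) +
      (a <= j < a + t) + (a + t <= j < (a + t).+1)).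
  rewrite /t1; case: (kE j) => [[-> ->]|[jb ->]|[jb ->]|].
  - rewrite p'0; lia.
  - lia.
  - rewrite p'2; lia.
  - move=> H; rewrite p'3; last by lia.
    by case: H => [[H ->]|[[H ->]|[H ->]]]; try lia; have := pt j H; lia.
have t2E j : t2 j = p j + ((0 <= j < 1) * t.+1 + (a.-1 <= j < a) * (a - b) +
    (a + t <= j < (a + t).+1)).
  case: j => [|i]; rewrite /t2.
    by case: (kE 0) => [[_ ->]|[? _]|[? _]|?]; rewrite ?p00; lia.
  case: (kE i.+1) => [[? _]|[jb ->]|[jb ->]|]; first by [].
  - rewrite !pl; try lia; have := p'1 i.+1; lia.
  - have [e|ne] := eqVneq i.+1 a.-1; first by rewrite e pb pl; lia.
    rewrite !pl; lia.
  - have npi := np i; case=> [[H ->]|[[H ->]|[H ->]]]; first by lia.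
      have pi : 0 < p i.
        have [t0|t0] := posnP t; last by apply: pt; lia.
        by have -> : i = a.-1; [lia|rewrite pb].
      have p1 : p i.+1 = 0 by (apply: p0; lia).
      rewrite p1; lia.
    have p1 : p i.+1 = 0 by (apply: p0; lia).
    rewrite p1; lia.
have S0 : \sum_(i < m) (i < 1) = 1 by apply: (@sum_indicator m 0 1); lia.
have S1 : \sum_(j < m) t1 j = \sum_(j < m) p' j + q.
  rewrite (eq_bigr _ (fun (j : 'I_m) _ => t1E j)).
  rewrite !big_split /= S0 !sum_indicator; rewrite /q; lia.
have S2 : \sum_(j < m) t2 j = \sum_(j < m) p j + q.
  rewrite (eq_bigr _ (fun (j : 'I_m) _ => t2E j)).
  rewrite !big_split /= -!big_distrl /= S0 !sum_indicator; rewrite /q; lia.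
have t2k j : t2 j <= kappa j by case: j => [|j] //=; lia.
have lek : \sum_(j < m) p j + q <= \sum_(j < m) kappa j.
  by rewrite -S2; apply: leq_sum.
split=> //; exists kappa, t1, t2.
have nk j : kappa j.+1 <= kappa j.
  have := np j; have := np' j; have := pab j.+1; have := p'1 j; have := p'1 j.+1.
  have : p' j.+1 <= a + t by apply: le; rewrite p0.
  have := pt j.
  by case: (kE j) => [[? ->]|[? ->]|[? ->]|[[? ->]|[[? ->]|[? ->]]]];
     case: (kE j.+1) => [[? ->]|[? ->]|[? ->]|[[? ->]|[[? ->]|[? ->]]]]; lia.
split=> // [j|j|j|].
- by rewrite /t1; have := nk j; have := np' j; lia.
- by rewrite t1E leq_addr -t1E geq_minl geq_minr.
- by rewrite [in p j <= _]t2E leq_addr t2k geq_minr.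
split=> //; move: lek; rewrite /kappa.
by move: (\sum_(j < m) kappa_corner a t p p' j) (\sum_(j < m) p j) => x y; lia.
Qed.

(** The row count turns out to be sharp. This fixes where [kappa] can exceed the union of [P] and
    [P'], and the number of new columns is then at most [q - 1]. *)
Lemma obstructed_corner m a b t (p p' P P' : nat -> nat) :
  a + t < m -> 0 < b < a -> (forall i, i < a.-1 -> p i = a) -> p a.-1 = b ->
  (forall i, a <= i < a + t -> 0 < p i) -> (forall i, a + t <= i -> p i = 0) ->
  (forall j, p j.+1 <= p j) -> (forall j, P j = p j + (j == a.-1)) ->
  transpose_of p p' -> transpose_of P P' ->
  let q := (a.-1 - b + t + 3) in
  \sum_(j < m) p j + q <= \sum_(j < m) kappa_corner a t p p' j ->
  obstructed m P P' q (\sum_(j < m) kappa_corner a t p p' j - \sum_(j < m) p j - q).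
Proof.
move=> atm /andP[b0 ba] pl pb pt p0 np Pp cp cP q lek kappa le sk rows cols.
have ge := conjugate_ge cp; have lep := conjugate_le cp.
have gE := conjugate_ge cP; have leP := conjugate_le cP.
have p00 : p 0 = a by apply: pl; lia.
have Pl i : i < a.-1 -> P i = a by move=> ia; rewrite Pp pl //; lia.
have Pb : P a.-1 = b.+1 by rewrite Pp pb eqxx addn1.
have Pt i : a <= i -> P i = p i by move=> ai; rewrite Pp; lia.
have P00 : P 0 = a by apply: Pl; lia.
have top (x : nat -> nat) x' : transpose_of x x' -> (forall i, a + t <= i -> x i = 0) ->
    (forall i, i < a + t -> 0 < x i) -> x' 0 = a + t.
  move=> c x0 xp; have := conjugate_le c (i := 0) (j := a + t); rewrite x0 // => /(_ isT).
  by have := conjugate_ge c (i := 0) (j := (a + t).-1); rewrite xp; lia.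
have ppos i : i < a + t -> 0 < p i.
  move=> iat; have [ia|ia] := ltnP i a.-1; first by rewrite pl //; lia.
  have [->|ne] := eqVneq i a.-1; first by rewrite pb.
  by apply: pt; lia.
have p'0 : p' 0 = a + t by apply: (top p).
have P'0 : P' 0 = a + t.
  apply: (top P) => // i lt; first by rewrite Pt ?p0 //; lia.
  by rewrite Pp; have := ppos _ lt; lia.
have p'1 i : i < b -> a <= p' i by move=> ib; have := ge i a.-1; rewrite pb; lia.
have P'1 i : i <= b -> a <= P' i by move=> ib; have := gE i a.-1; rewrite Pb; lia.
have p'2 i : b <= i < a -> p' i = a.-1.
  move=> /andP[bi ia]; have := ge i a.-2; rewrite pl; last by lia.
  by have := lep i a.-1; rewrite pb => H1 H2; have := H1 bi; have := H2 ia; lia.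
have P'2 i : b < i < a -> P' i = a.-1.
  move=> /andP[bi ia]; have := gE i a.-2; rewrite Pl; last by lia.
  by have := leP i a.-1; rewrite Pb => H1 H2; have := H1 bi; have := H2 ia; lia.
have p'3 i : a <= i -> p' i = 0.
  by move=> ai; have := lep i 0; rewrite p00 => /(_ ai); lia.
have P'3 i : a <= i -> P' i = 0.
  by move=> ai; have := leP i 0; rewrite P00 => /(_ ai); lia.
have P'p' i : i < b -> P' i = p' i.
  move=> ib; apply/eqP; rewrite eqn_leq.
  have H1 := p'1 i ib; have H2 := P'1 i (ltnW ib).
  apply/andP; split; rewrite leqNgt; apply/negP => lt; move: (lt).
    by rewrite cP Pt // -cp ltnn.
  by rewrite cp -Pt // -cP ltnn.
pose U i := maxn (P i) (P' i).
pose e := a.-1 - b.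
have U0 : U 0 = a + t by rewrite /U P'0 P00; lia.
have P'b : P' b <= a.
  by apply: leP; rewrite Pt //; have := np a.-1; rewrite prednK ?pb //; lia.
(* If [e = 0], the box added to [p] is the corner [(a - 1, a - 1)] itself and is already in the
   union [U]; otherwise [U] is still the union of [p] and [p'], which lacks all three corners. The
   interval from [a.-1] to [y] records this. *)
pose y := a - (e == 0).
have KU i : kappa_corner a t p p' i =
    U i + ((i < 1) + (a.-1 <= i < y) + (a + t <= i < (a + t).+1)).
  rewrite /kappa_corner; case: eqP => [->|/eqP i0]; first by rewrite U0 /y /e; lia.
  case: eqP => [->|/eqP ia].
    rewrite /U Pb /y; have [e0|ep] := posnP e.
      have eb : a.-1 = b by move: e0; rewrite /e; lia.
      by rewrite eb; have := P'1 b (leqnn b); lia.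
    rewrite P'2; last by move: ep; rewrite /e; lia.
    by move: ep; rewrite /e; lia.
  case: eqP => [->|/eqP iat]; first by rewrite /U P'3 ?Pt ?p0 /y; lia.
  have -> : (i < 1) + (a.-1 <= i < y) + (a + t <= i < (a + t).+1) = 0 by rewrite /y; lia.
  rewrite addn0 /U; have [ib|bi] := ltnP i b.
    by rewrite P'p' // Pl ?pl //; lia.
  have [ia1|ia1] := ltnP i a.-1; last by rewrite P'3 ?p'3 ?Pt //; lia.
  rewrite Pl // pl // (p'2 i); last by lia.
  have [ei|ne] := eqVneq i b; first by rewrite ei; lia.
  by rewrite P'2; lia.
have KE (i : 'I_m) : kappa i = U i + (kappa i - U i) by rewrite subnKC // le.
have S0 : \sum_(i < m) (i < 1) = 1 by apply: (@sum_indicator m 0 1); lia.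
have ya : y <= m by rewrite /y; lia.
have SP : \sum_(j < m) P j = \sum_(j < m) p j + 1.
  rewrite (eq_bigr (fun j : 'I_m => p j + (a.-1 <= j < a))) => [|j _].
    by rewrite big_split /= sum_indicator; lia.
  by rewrite Pp; congr (_ + nat_of_bool _); lia.
(* With [q] and [k] unchanged, [kappa] has one box more than [kappa_corner], which exceeds [U] by 3,
   or by 2 when [e = 0]. *)
have Sx : \sum_(i < m) (kappa i - U i) = 4 - (e == 0).
  move: sk lek; rewrite SP (eq_bigr _ (fun (i : 'I_m) _ => KE i)).
  rewrite [\sum_(i < m) kappa_corner _ _ _ _ _](eq_bigr _ (fun (i : 'I_m) _ => KU i)).
  rewrite !big_split /= S0 !sum_indicator //.
  move: (\sum_(i < m) U i) (\sum_(i < m) (kappa i - U i)) (\sum_(i < m) p i) => A B C.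
  by rewrite /y; clearbody q; clear -b0 ba; case: (e == 0); lia.
(* A row with [P' j < kappa j] either exceeds [U] or is one where [P] exceeds [P'], as in the two
   intervals. The right-hand sides add up to exactly [q], so equality holds in every row: the boxes
   outside [U] lie in distinct rows, none of them in those intervals. *)
have E := @sum_eq_pointwise m (fun j => P' j < kappa j)
   (fun j => (kappa j - U j) + ((b.+1 <= j < a.-1) + (a <= j < a + t))).
have {}E : forall j, j < m -> (P' j < kappa j) =
    (kappa j - U j) + ((b.+1 <= j < a.-1) + (a <= j < a + t)) :> nat.
  apply: E => [j jm|]; last first.
    apply: leq_trans rows; rewrite !big_split /= Sx !sum_indicator; rewrite /q /e; lia.
  have := le j jm; have [H|H] := leqP (P j) (P' j); first by rewrite /U; lia.
  have : (b.+1 <= j < a.-1) || (a <= j < a + t).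
    have [jb|bj] := leqP j b.
      have := P'1 j jb; have [jl|jl] := ltnP j a.-1; first by rewrite Pl // in H; lia.
      have ej : j = a.-1 by lia.
      by move: H; rewrite ej Pb; lia.
    have [ja|ja] := ltnP j a.-1; first by [].
    have [j1|j1] := eqVneq j a.-1.
      by rewrite j1 Pb P'2 in H; lia.
    have [jt|jt] := ltnP j (a + t); first by lia.
    by rewrite Pt ?p0 in H; lia.
  lia.
(* New columns can arise only in row 0, in row [a.-1], where [P] has length [b.+1], and in row
   [a + t]; the bounds add up to [q - 1]. *)
have : \sum_(j < m) new_cols P kappa j <=
   \sum_(j < m) ((j < 1) * t.+1 + (a.-1 <= j < a) * (a - b.+1) + (a + t <= j < (a + t).+1)).
  apply: leq_sum => -[j jm] _ /=; rewrite /new_cols.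
  have Ej := E j jm; have lej := le j jm.
  case: j jm Ej lej => [|i] im Ei lei.
    by move: Ei; rewrite U0 P00; clear; case: (P' 0 < _) => /=; lia.
  have [ia|ia] := ltnP i.+1 a.-1.
    by rewrite !Pl ?(ltnW ia) // (eqP (_ : minn _ _ - _ == 0)) // subn_eq0 geq_minr.
  have [ia1|ia1] := eqVneq i.+1 a.-1.
    rewrite ia1 Pb Pl; last by rewrite -ia1.
    by clear -b0 ba; lia.
  have ai : a <= i.+1 by clear -ia ia1; lia.
  move: Ei lei; rewrite /U P'3 //.
  have [it|it] := ltnP i.+1 (a + t).
    by clear -ai it; case: (0 < _) => /=; lia.
  have P1 : P i.+1 = 0 by rewrite Pt ?p0.
  have [eit|ne] := eqVneq i.+1 (a + t).
    by rewrite P1; clear -eit ai; case: (0 < _) => /=; lia.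
  have P2 : P i = 0 by rewrite Pt ?p0 //; clear -it ne ia1 ai; lia.
  by rewrite P2 minn0.
rewrite !big_split /= -!big_distrl /= S0 !sum_indicator; try lia.
move: cols; rewrite /q.
by move: (\sum_(j < m) new_cols P kappa j); lia.
Qed.

(** * The test functional *)

Local Open Scope ring_scope.

(** Replacing exponents [a] by [K - a] reverses their order; this is the sign of putting the columns
    back in decreasing order. *)
Definition rev_sign n : {mpoly int[n.+1]} := (-1) ^+ (perm (@rev_ord_inj n.+1)).

Lemma rev_sign_sqr n : rev_sign n * rev_sign n = 1.
Proof. by rewrite /rev_sign -expr2 sqrr_sign. Qed.

Lemma alt_rev n (P P' : 'I_n.+1 -> nat -> {mpoly int[n.+1]}) l l' :
  (forall i j, P i (l j) = P' i (l' (rev_ord j))) -> alt P l = rev_sign n * alt P' l'.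
Proof.
move=> h; rewrite /alt -[RHS]mulrC.
have -> : \matrix_(i, j) P i (l j) =
    col_perm (perm (@rev_ord_inj n.+1)) (\matrix_(i, j) P' i (l' j)).
  by apply/matrixP => i j; rewrite !mxE permE h.
by rewrite col_permE det_mulmx det_perm odd_permV.
Qed.

(** The shift by the staircase [(n, ..., 1, 0)] makes the vector of a partition strictly
    decreasing. *)
Definition expo n (p : nat -> nat) : {ffun 'I_n.+1 -> nat} :=
  [ffun j : 'I_n.+1 => (p j + (n - j))%N].

Lemma strict_expo n p : (forall j, p j.+1 <= p j)%N -> strict (expo n p).
Proof.
move=> np; apply: strict_adj => i j ij; rewrite !ffunE.
by have := np i; have := ltn_ord j; rewrite -ij; lia.
Qed.

Lemma sum_expo n p : (\sum_j expo n p j = \sum_(j < n.+1) p j + \sum_(j < n.+1) (n - j))%N.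
Proof. by rewrite -big_split; apply: eq_bigr => j _; rewrite ffunE. Qed.

Definition vstrip_boxes m q k (l : {ffun 'I_m -> nat}) := boxes k (sadd (vadd q) [:: l]).
Definition hstrip_boxes m q k (l : {ffun 'I_m -> nat}) := boxes k (sadd (hadd q) [:: l]).

Lemma mpoly_int_N m (x : {mpoly int[m]}) : x = - x -> x = 0.
Proof.
move=> e; apply/mpolyP => i; rewrite mcoeff0.
by have := congr1 (fun y => y@_i) e; rewrite mcoeffN; lia.
Qed.

Lemma sadd_strict_v m q (l x : {ffun 'I_m -> nat}) : x \in sadd (vadd q) [:: l] -> strict x.
Proof. by case/mem_sadd => y _ /vaddP[]. Qed.

Lemma sadd_strict_h m q (l x : {ffun 'I_m -> nat}) : x \in sadd (hadd q) [:: l] -> strict x.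
Proof. by case/mem_sadd => y _; apply: hadd_strict. Qed.

Definition vfactor m q k : {mpoly int[m]} :=
  symsum 2 q (@xpow m) * symsum 2 1 (@xpow m) ^+ k.

(* [hfactor] is, up to a power of the product of the variables, the value at the
   inverses of the variables of [h_q * e_1 ^ k]. *)
Definition hfactor m q k : {mpoly int[m]} :=
  symsum q.+1 q (@xcpow m q) * symsum 2 1 (@xcpow m 1) ^+ k.

Lemma alt_vfactor m q k (l : {ffun 'I_m -> nat}) : strict l ->
  alt (@xpow m) l * vfactor m q k = \sum_(x <- vstrip_boxes q k l) alt (@xpow m) x.
Proof.
move=> sl; have -> : alt (@xpow m) l = \sum_(x <- [:: l]) alt (@xpow m) x by rewrite big_seq1.
rewrite /vfactor mulrA.
rewrite (@sum_alt_vadd _ _ q _ (@xpow m)) => [|x|x _ i j g]; last by rewrite /xpow exprD.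
  rewrite (@sum_alt_boxes _ _ k (fun _ => @xpow m)) => // [x|k' x _ i j g].
    exact: sadd_strict_v.
  by rewrite /xpow exprD.
by rewrite inE => /eqP ->.
Qed.

Lemma le_of_sum m k (l l' : {ffun 'I_m -> nat}) :
  (forall j, l j <= l' j)%N -> (\sum_j l' j = \sum_j l j + k)%N ->
  forall j, (l' j <= l j + k)%N.
Proof.
move=> h sk j; rewrite -leq_subLR.
have <- : (\sum_i (l' i - l i) = k)%N by rewrite sumnB // sk addKn.
by rewrite (bigD1 j) //= leq_addr.
Qed.

Lemma mem_hstrip_boxes m q k (l x : {ffun 'I_m -> nat}) :
  x \in hstrip_boxes q k l -> strict x /\ forall j, (x j <= l j + q + k)%N.
Proof.
case/boxes_sound => [y|sx [y /mem_sadd[z]]]; first exact: sadd_strict_h.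
rewrite inE => /eqP -> /haddP[h1 _ h2] [h3 h4]; split=> // j.
by have := le_of_sum h1 h2 j; have := le_of_sum h3 h4 j; lia.
Qed.

Lemma alt_hfactor m K q k (l : {ffun 'I_m -> nat}) : strict l -> (forall j, l j <= K)%N ->
  alt (@xcpow m K) l * hfactor m q k =
  \sum_(x <- hstrip_boxes q k l) alt (@xcpow m (K + q + k)) x.
Proof.
move=> sl lK.
have -> : alt (@xcpow m K) l = \sum_(x <- [:: l]) alt (@xcpow m K) x by rewrite big_seq1.
rewrite /hfactor mulrA.
rewrite (@sum_alt_hadd _ _ q _ (@xcpow m (K + q))) => [|||x].
- rewrite -[in LHS](addn0 (K + q)%N).
  rewrite (@sum_alt_boxes _ _ k (fun k => @xcpow m (K + q + k))) => // [x|k' x].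
    exact: sadd_strict_h.
  case/mem_hstrip_boxes => _ h i j g; rewrite /xcpow -exprD; congr (_ ^+ _).
  have := h j; have := lK j; case: g => g g2 /=.
  move: (x j) (l j) => a b; lia.
- exact: mpoly_int_N.
- by move=> x; rewrite inE => /eqP ->.
rewrite inE => /eqP -> i j g; rewrite /xcpow -exprD; congr (_ ^+ _).
have := lK j; case: g => g gq /=; move: (l j) => b; lia.
Qed.

Lemma mcoeff_sum_alt m K (s1 s2 : seq {ffun 'I_m -> nat}) :
  (forall l, l \in s1 -> strict l) ->
  (forall l, l \in s2 -> strict l /\ forall j, (l j <= K)%N) ->
  ((\sum_(l <- s1) alt (@xpow m) l) * (\sum_(l <- s2) alt (@xcpow m K) l))@_[multinom K | _ < m]
  = \sum_(l <- s1) \sum_(l' <- s2) if l == l' then (m`!)%:R else 0.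
Proof.
move=> h1 h2; rewrite mulr_suml raddf_sum /= big_seq [RHS]big_seq.
apply: eq_bigr => l /h1 sl; rewrite mulr_sumr raddf_sum /= big_seq [RHS]big_seq.
by apply: eq_bigr => l' /h2[sl' lK]; rewrite mcoeff_alt_alt.
Qed.

(** The two Vandermonde determinants supply two alternants, one for each Pieri factor; [rev_sign]
    cancels the sign of writing one of them in reflected powers. *)
Definition test_poly n q k (f : {mpoly int[n.+1]}) : {mpoly int[n.+1]} :=
  rev_sign n * (alt (@xpow n.+1) (fun j => n - j)%N * alt (@xpow n.+1) (fun j => n - j)%N * f *
   (vfactor n.+1 q k * hfactor n.+1 q k)).

(** The exponent is [n + n.+1], a bound for the entries of [expo n p] when [p <= n.+1], plus the
    rise [q + k] due to [hfactor]. *)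
Definition test_coef n q k (f : {mpoly int[n.+1]}) : int :=
  (test_poly q k f)@_[multinom (n + n.+1 + q + k)%N | _ < n.+1].

Lemma test_coefB n q k (f g : {mpoly int[n.+1]}) :
  test_coef q k (f - g) = test_coef q k f - test_coef q k g.
Proof. by rewrite /test_coef /test_poly mulrBr mulrBl mulrBr mcoeffB. Qed.

Lemma test_coef_sumZ n q k (r : seq (seq nat)) c (F : seq nat -> {mpoly int[n.+1]}) :
  test_coef q k (\sum_(la <- r) c la *: F la) = \sum_(la <- r) c la * test_coef q k (F la).
Proof.
rewrite /test_coef /test_poly mulr_sumr mulr_suml mulr_sumr raddf_sum /=.
by apply: eq_bigr => la _; rewrite -scalerAr -scalerAl -scalerAr mcoeffZ.
Qed.

(** The second Vandermonde determinant is, in reflected powers, the alternant of the empty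
    partition. Both Pieri expansions have coefficients 1, so the pairing counts coincidences. *)
Lemma test_coef_schur n q k la : is_part la -> 0 <= test_coef q k (schur la n.+1).
Proof.
move=> pla; have [sl|sl] := ltnP n.+1 (size la).
  by rewrite /test_coef /test_poly schur_eq0 // mulr0 mul0r mulr0 mcoeff0.
have sla : sorted geq la by case/andP: pla.
pose l := expo n (nth 0%N la); pose z := expo n (fun _ => 0%N).
have st : strict l by apply: strict_expo => j; apply: is_part_nth.
have stz : strict z by apply: strict_expo.
have zn j : (z j <= n)%N by rewrite ffunE leq_subr.
(* The empty partition only needs reflection at [n + q + k]; adding [n.+1] to the exponents matches
   the larger value fixed in [test_coef]. *)
pose sh (x : {ffun 'I_n.+1 -> nat}) := [ffun j => (x j + n.+1)%N].
rewrite /test_coef.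
have -> : test_poly q k (schur la n.+1) =
   (\sum_(x <- vstrip_boxes q k l) alt (@xpow n.+1) x) *
   (\sum_(x <- map sh (hstrip_boxes q k z)) alt (@xcpow n.+1 (n + n.+1 + q + k)) x).
  rewrite -alt_vfactor // big_map.
  have -> : \sum_(j <- hstrip_boxes q k z) alt (xcpow (n + n.+1 + q + k)) (sh j) =
     alt (@xcpow n.+1 n) z * hfactor n.+1 q k.
    rewrite (alt_hfactor q k stz zn).
    apply: eq_bigr => x _.
    rewrite /alt.
    congr (\det _).
    apply/matrixP => i j.
    rewrite !mxE.
    by rewrite /sh ffunE /xcpow; congr (_ ^+ _); lia.
  have -> : alt (@xpow n.+1) l = alt (@xpow n.+1) (fun j => n - j)%N * schur la n.+1.
    by rewrite (alt_schur sla sl); apply: eq_alt => j; rewrite ffunE.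
  have E : alt (@xpow n.+1) (fun j => n - j)%N = rev_sign n * alt (@xcpow n.+1 n) z.
    apply: alt_rev => i j; rewrite ffunE /xcpow /xpow; congr (_ ^+ _).
    by rewrite /=; have := ltn_ord j; lia.
  rewrite /test_poly {1}E -[RHS]mul1r -(rev_sign_sqr n).
  move: (alt (xcpow n) z) (alt _ _) (schur la _) (vfactor _ _ _) (hfactor _ _ _) => a b c d e.
  by move: (rev_sign n) => s; ring.
rewrite mcoeff_sum_alt => [|x|x /mapP[y]].
- by apply: sumr_ge0 => x _; apply: sumr_ge0 => y _; case: ifP => // _; apply: ler0n.
- by case/boxes_sound => // y; apply: sadd_strict_v.
case/mem_hstrip_boxes => sy yK ->; split=> [|j].
  by apply/strictP => i j ij; rewrite !ffunE ltn_add2r; apply: (strictP _ sy).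
by rewrite ffunE; have := yK j; have := zn j; lia.
Qed.

Lemma test_coef_product n q k (la ka : seq nat) (p : nat -> nat) :
  sorted geq la -> (size la <= n.+1)%N -> sorted geq ka -> (size ka <= n.+1)%N ->
  (forall j, p j.+1 <= p j)%N -> (p 0 <= n.+1)%N ->
  (forall j, (j <= n)%N -> nth 0%N ka j = (n.+1 - p (n - j))%N) ->
  test_coef q k (schur la n.+1 * schur ka n.+1) =
  \sum_(l <- vstrip_boxes q k (expo n (nth 0%N la)))
    \sum_(l' <- hstrip_boxes q k (expo n p)) if l == l' then ((n.+1)`!)%:R else 0.
Proof.
move=> sla nla ska nka np p0 kap.
pose l := expo n (nth 0%N la); pose z := expo n p.
have st : strict l by apply: strict_expo => j; apply: is_part_nth.
have stz : strict z by apply: strict_expo.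
have pn j : (p j <= n.+1)%N by elim: j => // j; apply: leq_trans.
have zn j : (z j <= n + n.+1)%N by rewrite ffunE; have := pn j; lia.
rewrite -(@mcoeff_sum_alt _ (n + n.+1 + q + k)%N); last first.
- by move=> x; case/mem_hstrip_boxes => sy yK; split=> // j;
     have := yK j; rewrite -/z; have := zn j; move: (x j) (z j) => u v; lia.
- by move=> x; case/boxes_sound => // y; apply: sadd_strict_v.
rewrite /test_coef; congr (_@__); rewrite -(alt_vfactor q k st) -(alt_hfactor q k stz zn).
have -> : alt (@xpow n.+1) l = alt (@xpow n.+1) (fun j => n - j)%N * schur la n.+1.
  by rewrite (alt_schur sla nla); apply: eq_alt => j; rewrite ffunE.
(* Row [j] of the complement has exponent [n.+1 - p (n - j) + (n - j)], which is [n + n.+1] minus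
   the exponent of [p] in row [n - j]. *)
have E : alt (@xpow n.+1) (fun j => n - j)%N * schur ka n.+1 =
    rev_sign n * alt (@xcpow n.+1 (n + n.+1)) z.
  rewrite (alt_schur ska nka); apply: alt_rev => i j.
  rewrite ffunE /xcpow /xpow; congr (_ ^+ _).
  have jn : (j <= n)%N by rewrite -ltnS.
  by rewrite kap //= subSS; have := pn (n - j)%N; lia.
have E' : alt (@xcpow n.+1 (n + n.+1)) z =
    rev_sign n * (alt (@xpow n.+1) (fun j => n - j)%N * schur ka n.+1).
  by rewrite E mulrA rev_sign_sqr mul1r.
rewrite E' /test_poly.
move: (alt _ _) (schur la _) (schur ka _) (vfactor _ _ _) (hfactor _ _ _) => a b c d e.
by move: (rev_sign n) => s; ring.
Qed.

Lemma fillable_common n (p p' : nat -> nat) q k :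
  (forall j, p j.+1 <= p j)%N -> (forall j, p' j.+1 <= p' j)%N ->
  (\sum_(j < n.+1) p' j = \sum_(j < n.+1) p j)%N ->
  fillable n.+1 p p' q k ->
  exists2 l, l \in vstrip_boxes q k (expo n p') & l \in hstrip_boxes q k (expo n p).
Proof.
move=> np np' sp [ka [t1 [t2 [nk nt1 h1 h2 [s0 s1 s2]]]]].
have st2 j : (t2 j.+1 <= t2 j)%N by have := h2 j; lia.
exists (expo n ka).
  apply: (@boxes_complete _ _ _ (expo n t1)); try exact: strict_expo.
  - apply/mem_sadd; exists (expo n p'); rewrite ?inE //; apply/vaddP; split.
    + exact: strict_expo.
    + by move=> j; rewrite !ffunE; have := h1 j; lia.
    + by rewrite !sum_expo s1; lia.
  - by move=> j; rewrite !ffunE; have := h1 j; lia.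
  - by rewrite !sum_expo s0 s1 sp; lia.
apply: (@boxes_complete _ _ _ (expo n t2)); try exact: strict_expo.
- apply/mem_sadd; exists (expo n p); rewrite ?inE //; apply/haddP; split.
  + by move=> j; rewrite !ffunE; have := h2 j; lia.
  + by move=> i j ij; rewrite !ffunE -ij; have := h2 i; have := ltn_ord j; lia.
  + by rewrite !sum_expo s2; lia.
- by move=> j; rewrite !ffunE; have := h2 j; lia.
- by rewrite !sum_expo s0 s2; lia.
Qed.

Lemma obstructed_disjoint n (p p' : nat -> nat) q k l :
  obstructed n.+1 p p' q k ->
  l \in vstrip_boxes q k (expo n p') -> l \in hstrip_boxes q k (expo n p) -> False.
Proof.
move=> ob; case/boxes_sound => [y|_ [t1 /mem_sadd[z]]]; first exact: sadd_strict_v.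
rewrite inE => /eqP -> /vaddP[_ a1 a2] [a3 _].
case/boxes_sound => [y|_ [t2 /mem_sadd[z']]]; first exact: sadd_strict_h.
rewrite inE => /eqP -> /haddP[b1 b2 b3] [b4 b5].
(* The default of [inord] beyond [n] is harmless: the conditions of [obstructed] look only at the
   first [n.+1] rows. *)
pose ka j := (l (inord j) - (n - j))%N.
have kE (j : 'I_n.+1) : (l j = ka j + (n - j))%N.
  rewrite /ka inord_val subnK //.
  by apply: leq_trans (b4 j); apply: leq_trans (b1 j); rewrite ffunE leq_addl.
have eS : (\sum_j l j = \sum_(j < n.+1) ka j + \sum_(j < n.+1) (n - j))%N.
  by rewrite -big_split; apply: eq_bigr => j _; apply: kE.
apply: (ob ka).
- move=> j jn; have := kE (Ordinal jn); have := a1 (Ordinal jn); have := a3 (Ordinal jn).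
  by have := b1 (Ordinal jn); have := b4 (Ordinal jn); rewrite !ffunE /=; lia.
- apply: (@addIn (\sum_(j < n.+1) (n - j))%N).
  by rewrite -eS b5 b3 sum_expo (addnAC _ _ q) (addnAC _ _ k).
- rewrite -(leq_add2l (\sum_j expo n p' j)) -a2 -big_split /=.
  apply: leq_sum => j _; have := kE j; have := a1 j; have := a3 j; rewrite !ffunE.
  by move: (l j) (t1 j) (ka j) (p' j) (n - j)%N => x y u v w; lia.
rewrite -(leq_add2l (\sum_j expo n p j)) -b3 -big_split /=.
apply: leq_sum => -[[|j] jn] _; have := kE (Ordinal jn); have := b1 (Ordinal jn);
  have := b4 (Ordinal jn); rewrite !ffunE /new_cols /=; first by lia.
have jn' : (j < n.+1)%N by apply: ltnW.
have := b2 (Ordinal jn') (Ordinal jn) (erefl _); rewrite !ffunE /=; lia.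
Qed.

Local Close Scope ring_scope.

(** * From partitions to row functions, and the case distinction *)

Lemma conjugate_conj_part la : sorted geq la ->
  transpose_of (nth 0 la) (nth 0 (conj_part la)).
Proof.
move=> sl i j.
have cnt : (j < count (fun a => i < a) la) = (i < nth 0 la j).
  elim: la sl j => [|x s IH] sl j /=; first by rewrite nth_nil.
  have [ix|xi] := ltnP i x.
    case: j => [|j] /=; first by rewrite ix.
    by rewrite add1n ltnS IH //; apply: path_sorted sl.
  have all_le y : y \in x :: s -> y <= i.
    move=> /(nthP 0)[k ks <-]; apply: leq_trans xi.
    exact: (is_part_nth (la := x :: s) (i := 0)).
  have -> : count (fun a => i < a) s = 0.
    apply/eqP; rewrite -leqn0 leqNgt -has_count; apply/hasPn => y ys.
    by rewrite -leqNgt all_le // inE ys orbT.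
  rewrite add0n ltn0; symmetry; apply/negbTE; rewrite -leqNgt.
  have [jl|jl] := ltnP j (size (x :: s)); last by rewrite nth_default.
  by apply: all_le; rewrite mem_nth.
have [il|li] := ltnP i (head 0 la); first by rewrite nth_mkseq.
rewrite nth_default ?size_mkseq // ltn0; symmetry; apply/negbTE; rewrite -leqNgt.
by apply: leq_trans li; rewrite -nth0; apply: is_part_nth.
Qed.

Lemma sorted_geq_nth la : (forall j, nth 0 la j.+1 <= nth 0 la j) -> sorted geq la.
Proof. by move=> h; apply/(sortedP 0) => i _; apply: h. Qed.

Lemma nth_gt0 la i : is_part la -> (0 < nth 0 la i) = (i < size la).
Proof.
case/andP=> _ n0; have [il|li] := ltnP i (size la); last by rewrite nth_default.
by rewrite lt0n; apply/eqP => e; move: n0; rewrite -e mem_nth.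
Qed.

Lemma sum_conjugate m (p p' : nat -> nat) : transpose_of p p' ->
  (forall j, p j <= m) -> (forall j, p' j <= m) ->
  \sum_(j < m) p' j = \sum_(j < m) p j.
Proof.
move=> c pm pm'.
have E f : (forall j, f j <= m) -> \sum_(j < m) f j = \sum_(j < m) \sum_(i < m) (i < f j).
  by move=> fm; apply: eq_bigr => j _; rewrite (@sum_indicator m 0 (f j)) // subn0.
rewrite (E p') // (E p) // exchange_big; apply: eq_bigr => i _; apply: eq_bigr => j _.
by rewrite c.
Qed.

Lemma sum_nth_sumn m la : size la <= m -> \sum_(j < m) nth 0 la j = sumn la.
Proof.
move=> sm; rewrite sumnE (big_nth 0) big_mkord.
rewrite [RHS](big_ord_widen m (fun j => nth 0 la j)) // [RHS]big_mkcond /=.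
by apply: eq_bigr => j _; case: ltnP => // le; rewrite nth_default.
Qed.

Lemma compl_partE m la : (forall j, nth 0 la j < m) ->
  compl_part m la = rev (mkseq (fun i => m - nth 0 la i) m).
Proof.
move=> h; apply/all_filterP/allP => x; rewrite mem_rev => /mapP[i _ ->].
by rewrite subn_gt0.
Qed.

Lemma size_compl_part m la : (forall j, nth 0 la j < m) -> size (compl_part m la) = m.
Proof. by move=> h; rewrite compl_partE // size_rev size_mkseq. Qed.

Lemma nth_compl_part n la : (forall j, nth 0 la j < n.+1) -> forall j, j <= n ->
  nth 0 (compl_part n.+1 la) j = n.+1 - nth 0 la (n - j).
Proof.
move=> h j jn; rewrite compl_partE // nth_rev size_mkseq ?ltnS //.
by rewrite nth_mkseq subSS // ltnS leq_subr.
Qed.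

Lemma test_coef_covers n q k (la : seq nat) : is_part la ->
  head 0 la <= n -> size la <= n.+1 ->
  test_coef q k (schur (conj_part la) n.+1 * schur (compl_part n.+1 la) n.+1)%R =
  (\sum_(l <- vstrip_boxes q k (expo n (nth 0 (conj_part la))))
    \sum_(l' <- hstrip_boxes q k (expo n (nth 0 la))) if l == l' then ((n.+1)`!)%:R else 0)%R.
Proof.
move=> /andP[sla _] hn sn; have nl j := is_part_nth (j := j.+1) sla (leqnSn j).
have lt j : nth 0 la j < n.+1.
  by rewrite ltnS; apply: leq_trans hn; rewrite -nth0; apply: is_part_nth.
have cp := conjugate_conj_part sla.
apply: test_coef_product => //.
- by apply: sorted_geq_nth; apply: conjugate_noninc cp.
- by rewrite size_mkseq ltnW.
- apply: sorted_geq_nth => j; have [jn|nj] := leqP j.+1 n.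
    rewrite !nth_compl_part //; last exact: ltnW.
    by apply: leq_sub2l; apply: is_part_nth => //; apply: leq_sub2l.
  by rewrite [nth _ _ j.+1]nth_default // size_compl_part.
- by rewrite size_compl_part.
- exact/ltnW/lt.
- exact: nth_compl_part.
Qed.

(** The product for [mu] has test value 0 and the one for [nu] a positive value, so the difference
    has a negative one, which Schur-positivity forbids. *)
Lemma not_covers_of_obstructed n q k (mu nu : seq nat) : is_part mu -> is_part nu ->
  head 0 mu <= n -> size mu <= n.+1 -> head 0 nu <= n -> size nu <= n.+1 ->
  fillable n.+1 (nth 0 nu) (nth 0 (conj_part nu)) q k ->
  obstructed n.+1 (nth 0 mu) (nth 0 (conj_part mu)) q k ->
  ~ covers n.+1 mu nu.
Proof.
move=> pmu pnu hmu smu hnu snu fil obs [_ _ [r [c [[_ /allP rp exp] cpos]]]].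
have := congr1 (test_coef q k) (exp n.+1).
rewrite test_coefB test_coef_sumZ !test_coef_covers //.
rewrite [X in (X - _)%R]big1_seq ?sub0r => [|l /andP[_ lv]]; last first.
  rewrite big1_seq // => l' /andP[_ lh]; case: eqP => // e; rewrite -e in lh.
  by case: (obstructed_disjoint obs lv lh).
have snu' : sorted geq nu by case/andP: pnu.
have cp := conjugate_conj_part snu'.
have pm j : nth 0 nu j <= n.+1.
  by apply: leq_trans (leqW hnu); rewrite -nth0; apply: is_part_nth.
have pm' j : nth 0 (conj_part nu) j <= n.+1.
  by apply: (conjugate_le cp); rewrite nth_default.
have [l lv lh] := fillable_common (fun j => is_part_nth snu' (leqnSn j))
  (conjugate_noninc cp) (sum_conjugate cp pm pm') fil.
move=> e; have : (0 <= \sum_(la <- r) c la * test_coef q k (schur la n.+1))%R.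
  rewrite big_seq; apply: sumr_ge0 => la lar.
  by apply: mulr_ge0; [exact: cpos|apply: test_coef_schur; exact: rp].
rewrite -e oppr_ge0 => /(Order.POrderTheory.lt_le_trans _) H.
suff: (0 < 0 :> int)%R by []; apply: H.
have pos (x y : {ffun 'I_n.+1 -> nat}) : (0 <= (if x == y then ((n.+1)`!)%:R else 0) :> int)%R.
  by case: ifP => // _; apply: ler0n.
(* The common vector [l], paired with itself, contributes a positive factorial; the remaining pairs
   contribute nonnegative terms. *)
rewrite (big_rem l) //= (big_rem l lh) /= eqxx.
apply: ltr_wpDr; first by apply: sumr_ge0 => x _; apply: sumr_ge0.
apply: ltr_wpDr; first by apply: sumr_ge0.
by rewrite ltr0n fact_gt0.
Qed.

Lemma eq_part la ka : 0 \notin la -> 0 \notin ka -> nth 0 la =1 nth 0 ka -> la = ka.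
Proof.
move=> l0 k0 e.
have le la' ka' : 0 \notin la' -> nth 0 la' =1 nth 0 ka' -> size la' <= size ka'.
  move=> n0 e'; rewrite leqNgt; apply/negP => lt; move: n0.
  by rewrite -[0](nth_default 0 (leqnn (size ka'))) -e' mem_nth.
apply: (@eq_from_nth _ 0) => [|i _]; last exact: e.
by apply/eqP; rewrite eqn_leq !le // => i; rewrite e.
Qed.

Lemma added_box m (p P : nat -> nat) : (forall j, p j <= P j) ->
  (forall j, m <= j -> P j = 0) -> \sum_(j < m) P j = (\sum_(j < m) p j).+1 ->
  exists2 r, r < m & forall j, P j = p j + (j == r).
Proof.
move=> le P0 sP.
have [r Hr] : exists r : 'I_m, p r < P r.
  apply/existsP; apply: contraT => /existsPn hn.
  have : \sum_(j < m) P j <= \sum_(j < m) p j by apply: leq_sum => i _; rewrite leqNgt hn.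
  by rewrite sP ltnn.
exists r => // j.
have E := @sum_eq_pointwise m (fun j => p j + (r <= j < r.+1)) P.
have {}E : forall j, j < m -> p j + (r <= j < r.+1) = P j.
  apply: E => [i im|]; last by rewrite big_split /= sum_indicator // subSnn sP addn1.
  have [->|ne] := eqVneq i r; first by lia.
  by have := le i; lia.
have [jm|mj] := ltnP j m; first by rewrite -E //; congr (_ + nat_of_bool _); lia.
have := le j; have := P0 j mj; have := ltn_ord r; lia.
Qed.

Theorem mainTheorem2 (nu : seq nat) (hnu : is_part nu) (htype : type1 nu)
    (hrect : part_incl (nseq (head 0 nu).-1 (head 0 nu)) nu)
    (mu : seq nat) (hmu : is_part mu) (hsub : part_incl nu mu)
    (hsize : sumn mu = (sumn nu).+1) (hne : mu <> incr_nth nu 0)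
    (m : nat) (hm : head 0 mu + size mu <= m) :
  ~ covers m mu nu.
Proof.
have [snu nz] := andP hnu; have [smu mz] := andP hmu.
set p := nth 0 nu; set P := nth 0 mu.
have np j : p j.+1 <= p j by apply: is_part_nth.
have nP j : P j.+1 <= P j by apply: is_part_nth.
have mu_gt0 : 0 < size mu by case: (mu) hsize.
have snm : size nu <= size mu.
  rewrite leqNgt -(nth_gt0 _ hnu) -leqNgt; apply: leq_trans (hsub _) _.
  by rewrite nth_default.
have m_gt0 : 0 < m by apply: leq_trans hm; rewrite addn_gt0 mu_gt0 orbT.
(* The side is [n.+1]. As [mu] is not empty, its first part is at most [n], so the complements of
   [mu] and [nu] have no zero entries. *)
case: m hm m_gt0 => // n hm _.
have hd_mu : head 0 mu <= n by move: hm; lia.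
have sz_mu : size mu <= n.+1 by move: hm; lia.
have sz_nu : size nu <= n.+1 by exact: leq_trans sz_mu.
have hd_nu : head 0 nu <= n by apply: leq_trans hd_mu; rewrite -!nth0; apply: hsub.
have [r rn PE] : exists2 r, r < n.+1 & forall j, P j = p j + (j == r).
  apply: added_box => // [j nj|]; first by rewrite /P nth_default // (leq_trans sz_mu).
  by rewrite !sum_nth_sumn.
have r0 : r != 0.
  apply/eqP => r0; apply: hne; apply: eq_part => // [|j].
    by case: (nu) nz => [//|x s]; rewrite !inE /= !negb_or => /andP[_ ->].
  by rewrite nth_incr_nth -/(P j) PE r0 addnC eq_sym.
set a := head 0 nu; have p0a : p 0 = a by rewrite /p nth0.
have pa j : p j <= a by rewrite -p0a; apply: is_part_nth.
have P0 : P 0 = a by rewrite PE p0a; lia.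
have pra : p r < a.
  by rewrite -P0; apply: leq_trans (is_part_nth smu (leq0n r)); rewrite -/(P r) PE eqxx addn1.
have cp := conjugate_conj_part snu; have cP := conjugate_conj_part smu.
(* If [r >= a], the union of the diagram and its transpose suffices; otherwise the rectangle forces
   [r = a.-1] and the three corners are used. *)
have [ar|ra] := leqP a r.
  apply: (not_covers_of_obstructed (q := 0) hmu hnu) => //; first apply: fillable_union => //.
    exact: conjugate_noninc cp.
  by apply: (obstructed_outside pa _ rn PE cp cP); rewrite pra ar.
have pl i : i < a.-1 -> p i = a.
  move=> ia; apply/eqP; rewrite eqn_leq pa /=.
  by have := hrect i; rewrite nth_nseq ia.
have er : r = a.-1.
  apply/eqP; rewrite eqn_leq; apply/andP; split; first by lia.
  by rewrite leqNgt; apply/negP => /pl e; rewrite e ltnn in pra.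
(* Here [a >= 2], as [r] is not 0, and the type 1 staircase has the part 2 in row [a.-1]. *)
have b0 : 0 < p a.-1.
  have := htype a.-1; rewrite -/a -/(p _); apply: leq_trans.
  have -> : a.-1 = (a.-2).+1 by lia.
  rewrite /= nth_rev size_iota; last by lia.
  by rewrite nth_iota; lia.
have a_le : a <= size nu by rewrite -(ltn_predK pra) -(nth_gt0 _ hnu) -/(p _).
set t := size nu - a.
(* The corner [(a + t, 0)] needs one row more than [nu] has; the bound on the side provides it
   because [head 0 mu] is positive. *)
have at_n : a + t < n.+1.
  have : a <= head 0 mu by rewrite -nth0 -/P P0.
  by rewrite /t; move: hm; lia.
have bE : 0 < p a.-1 < a by rewrite b0 -er pra.
have pt i : a <= i < a + t -> 0 < p i.
  by move=> /andP[_]; rewrite nth_gt0 // /t; lia.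
have pz i : a + t <= i -> p i = 0.
  by move=> le; rewrite /p nth_default //; move: le; rewrite /t; lia.
rewrite er in PE.
have [fil lek] := fillable_corner at_n bE pl (erefl _) pt pz np cp.
apply: (not_covers_of_obstructed hmu hnu _ _ _ _ fil) => //.
exact: (obstructed_corner at_n bE pl (erefl _) pt pz np PE cp cP lek).
Qed.
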